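(* Let $p>1$, let $q$ be defined by $p^{-1}+q^{-1}=1$, let $n\ge 1$, and let $Y_1,\ldots,Y_n$ be i.i.d. random variables with density $f(y)$ on $\mathbf{R}_+=(0,\infty)$ such that the function $$x\mapsto \min\{0,\,2/p-1\}\log x+\log f(x^{1/p})$$ is concave in $x\in\mathbf{R}_+$. Then, for each $t>0$, $\Pr\left(\sum_{i=1}^n a_iY_i\le t\right)$, $a\in\mathbf{R}_+^n$, is a Schur-convex function of $a^q\equiv(a_1^q,\ldots,a_n^q)\in\mathbf{R}_+^n$ (that is, $c\mapsto\Pr\left(\sum_{i=1}^n c_i^{1/q}Y_i\le t\right)$ is Schur-convex on $\mathbf{R}_+^n$). Equivalently, if $a,b\in\mathbf{R}_+^n$, then $$a^q\prec b^q\quad\Longrightarrow\quad \sum_{i=1}^n b_iY_i\le_{\mathrm{st}}\sum_{i=1}^n a_iY_i .$$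
   Context: Usual stochastic order: for real random variables $X,Y$, $X\le_{\mathrm{st}}Y$ means $\Pr(X>t)\le\Pr(Y>t)$ for all $t\in\mathbf{R}$. Majorization: for $a,b\in\mathbf{R}^n$, $a\prec b$ means (i) $\sum_{i=1}^n a_i=\sum_{i=1}^n b_i$ and (ii) $\sum_{i=k}^n a_{(i)}\le\sum_{i=k}^n b_{(i)}$ for $k=2,\ldots,n$, where $a_{(1)}\le\cdots\le a_{(n)}$ and $b_{(1)}\le\cdots\le b_{(n)}$ are the coordinates arranged in increasing order. A function $\phi$ symmetric in its $n$ coordinates is Schur-concave if $a\prec b$ implies $\phi(a)\ge\phi(b)$, and Schur-convex if $-\phi$ is Schur-concave. ''Density'' means density with respect to Lebesgue measure. With the convention $\log 0=-\infty$, concavity of the displayed function is in the extended sense: the set of $x\in\mathbf{R}_+$ with $f(x^{1/p})>0$ is convex and the function is concave on that set (equivalently, $x^{\min\{0,2/p-1\}}f(x^{1/p})$ is log-concave on $\mathbf{R}_+$). *)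

(* Defs.v *)
From HB Require Import structures.
From mathcomp Require Import all_boot all_order all_algebra perm.
From mathcomp Require Import all_classical all_reals all_analysis.
From mathcomp Require Import measurable_realfun.

Set Implicit Arguments.
Unset Strict Implicit.
Unset Printing Implicit Defensive.

Import Order.TTheory GRing.Theory Num.Theory.
Import numFieldNormedType.Exports.

Local Open Scope classical_set_scope.
Local Open Scope ring_scope.

(* The two variables may live on different probability spaces. *)
Definition st_le (R : realType)
    (d1 : measure_display) (T1 : measurableType d1) (P1 : probability T1 R)
    (d2 : measure_display) (T2 : measurableType d2) (P2 : probability T2 R)
    (X : {RV P1 >-> R}) (Y : {RV P2 >-> R}) : Prop :=
  forall t : R, (ccdf X t <= ccdf Y t)%E.

(* The product rule over every finite subfamily. *)
Definition mutually_independent (R : realType)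
    (d : measure_display) (T : measurableType d) (P : probability T R)
    (I : finType) (Y : I -> {RV P >-> R}) : Prop :=
  forall (J : {set I}) (A : I -> set R),
    (forall i, i \in J -> measurable (A i)) ->
    P (\bigcap_(i in [set` J]) (Y i @^-1` A i)) =
    (\prod_(i in J) P (Y i @^-1` A i))%E.

(* [f] is a density of [X] carried by [D]; taking [A := setT], the last clause
   forces [f] to integrate to 1 over [D]. Values of [f] outside [D] are
   irrelevant. *)
Definition has_density_on (R : realType)
    (d : measure_display) (T : measurableType d) (P : probability T R)
    (X : {RV P >-> R}) (D : set R) (f : R -> R) : Prop :=
  [/\ measurable_fun D f,
      forall y, D y -> 0 <= f y
    & forall A : set R, measurable A ->
        distribution P X A =
        (\int[lebesgue_measure]_(y in A `&` D) (f y)%:E)%E].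

Definition weighted_sum_fun (R : realType)
    (d : measure_display) (T : measurableType d) (P : probability T R) (n : nat)
    (a : 'rV[R]_n) (Y : 'I_n -> {RV P >-> R}) : T -> R :=
  fun w => \sum_(i < n) a 0 i * Y i w.

Lemma measurable_weighted_sum (R : realType)
    (d : measure_display) (T : measurableType d) (P : probability T R) (n : nat)
    (a : 'rV[R]_n) (Y : 'I_n -> {RV P >-> R}) :
  measurable_fun [set: T] (weighted_sum_fun a Y).
Proof. by apply: measurable_sum => i; exact: measurable_funM. Qed.

HB.instance Definition _ (R : realType)
    (d : measure_display) (T : measurableType d) (P : probability T R) (n : nat)
    (a : 'rV[R]_n) (Y : 'I_n -> {RV P >-> R}) :=
  isMeasurableFun.Build _ _ T R (weighted_sum_fun a Y)
    (measurable_weighted_sum a Y).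

Definition weighted_sum (R : realType)
    (d : measure_display) (T : measurableType d) (P : probability T R) (n : nat)
    (a : 'rV[R]_n) (Y : 'I_n -> {RV P >-> R}) : {RV P >-> R} :=
  weighted_sum_fun a Y.

Definition positive_orthant (R : realType) (n : nat) : set 'rV[R]_n :=
  [set a | forall i, 0 < a 0 i].

Definition entrywise_powR (R : realType) (n : nat) (a : 'rV[R]_n) (r : R) :
    'rV[R]_n :=
  map_mx (fun x => x `^ r) a.

(* The [k]-th smallest coordinate of [a], counted from [k = 1]. *)
Definition order_stat (R : realType) (n : nat) (a : 'rV[R]_n) (k : nat) : R :=
  nth 0 (sort <=%R [seq a 0 i | i : 'I_n]) k.-1.

Definition majorized (R : realType) (n : nat) (a b : 'rV[R]_n) : Prop :=
  \sum_(i < n) a 0 i = \sum_(i < n) b 0 i /\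
  forall k : nat, (2 <= k <= n)%N ->
    \sum_(k <= i < n.+1) order_stat a i <= \sum_(k <= i < n.+1) order_stat b i.

(* [D] is meant to be stable under permutation of the coordinates. *)
Definition schur_concave (R : realType) (n : nat) (D : set 'rV[R]_n)
    (phi : 'rV[R]_n -> R) : Prop :=
  (forall (s : 'S_n) (a : 'rV[R]_n), D a -> phi (col_perm s a) = phi a) /\
  (forall a b : 'rV[R]_n, D a -> D b -> majorized a b -> phi b <= phi a).

Definition schur_convex (R : realType) (n : nat) (D : set 'rV[R]_n)
    (phi : 'rV[R]_n -> R) : Prop :=
  schur_concave D (fun a => - phi a).

(* Concavity on [D] of a function that may take the value -oo (but not +oo):
   its effective domain is convex and it is concave there. *)
Definition ext_concave (R : realType) (D : set R) (g : R -> \bar R) : Prop :=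
  let S : set R^o := D `&` [set x | (-oo < g x)%E] in
  convex_set S /\ convex_function S (fun x => - fine (g x)).

(* Main.v *)
From HB Require Import structures.
Require Import Defs.
From mathcomp Require Import all_boot all_order all_algebra perm ring lra.
From mathcomp Require Import all_classical all_reals all_analysis.
From mathcomp Require Import measurable_realfun.

Set Implicit Arguments.
Unset Strict Implicit.
Unset Printing Implicit Defensive.

Import Order.TTheory GRing.Theory Num.Theory.
Import numFieldNormedType.Exports.

Local Open Scope classical_set_scope.
Local Open Scope ring_scope.

(* Majorization reduces to transfers between two coordinates, and independence
   lets one condition on the other summands, so the heart of the matter is
   n = 2. Put X_i = Y_i^p and c_i = a_i^q, so that a_1 Y_1 + a_2 Y_2 =
   c_1^(1/q) X_1^(1/p) + c_2^(1/q) X_2^(1/p), with C = c_1 + c_2 fixed, and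
   condition on X_1 + X_2 = s. With m = min(1/p, 1/q), the density of (X_1, X_2)
   along this line is (x (s - x))^(-m) H(x), and the log-concavity hypothesis
   makes H symmetric and unimodal about s/2.
   The event {a_1 Y_1 + a_2 Y_2 > t} is there an interval ]a, b[ which moves to
   the right as c_1 >= C/2 grows, and its centre is at least s/2. Hence H is at
   most H(b) on the mass gained at b and at least H(b) on the mass lost at a, and
   it suffices that the weight (x (s - x))^(-m) gained at b is at most the one
   lost at a. By concavity of (c, x) |-> c^(1/q) x^(1/p), tangent planes at the
   two end points bound both displacements in the right directions, and the
   comparison of the two rates reduces to the monotonicity of the chord slopes
   of a concave power. *)

(** * Weighted arithmetic-geometric mean and concave powers *)

(** The mass [Phi c] of the superlevel set is never differentiated in [c]: [H] is only measurable
    and unimodal, not continuous. Instead, for every [e > 0], [Phi c1 <= Phi c + e * (c1 - c)] holds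
    for [c1] slightly above [c], and upper bounds pass to limits from the left; an induction along
    the real line turns these two facts into monotonicity. The picture of a moving interval needs
    [c^be * s^al < t < C^be * s^al], with [al = 1/p] and [be = 1/q]. The upper threshold is the
    maximum of [L c], the same for all [c], and at or above it the superlevel sets are empty. The
    lower threshold is the value at [x = s]; once [t] is at or below it, the right end no longer
    moves and the superlevel sets simply shrink as [c] grows. The exponent [m] is the minimum of
    [al] and [be] because weight times speed of an end point then becomes a chord slope, or the
    inverse of one, of a power with exponent [al/be] or [be/al], whichever is at most 1. *)

Section weighted_amgm.
Context {R : realType}.
Implicit Types (al be x y u v : R).

Lemma weighted_amgm al be u v : 0 < al -> 0 < be -> al + be = 1 ->
  0 <= u -> 0 <= v -> u `^ be * v `^ al <= be * u + al * v.
Proof.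
move=> al0 be0 ab u0 v0.
have := @conjugate_powR R (u `^ be) (v `^ al) be^-1 al^-1 (powR_ge0 _ _)
  (powR_ge0 _ _).
rewrite -!powRrM !divff ?gt_eqF// !powRr1// !invrK (mulrC u) (mulrC v).
by apply; rewrite ?invr_gt0// addrC.
Qed.

(** Weighted AM-GM at [c / c0] and [x / x0], scaled by [c0^be * x0^al]. Homogeneity of degree 1
    makes the resulting bound the tangent plane at [(c0, x0)]. *)
Lemma powR_mul_tangent al be c0 x0 c x : 0 < al -> 0 < be -> al + be = 1 ->
  0 < c0 -> 0 < x0 -> 0 <= c -> 0 <= x ->
  c `^ be * x `^ al <=
  c0 `^ be * x0 `^ al + (c - c0) * (be * (x0 / c0) `^ al)
                      + (x - x0) * (al * (c0 / x0) `^ be).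
Proof.
move=> al0 be0 ab c00 x00 c1 x1.
have := @weighted_amgm al be (c / c0) (x / x0) al0 be0 ab
  (divr_ge0 c1 (ltW c00)) (divr_ge0 x1 (ltW x00)).
have K0 : 0 < c0 `^ be * x0 `^ al by rewrite mulr_gt0// powR_gt0.
rewrite -(ler_pM2l K0).
rewrite mulrACA -!powRM ?divr_ge0 ?(ltW c00) ?(ltW x00)//.
have -> : c0 * (c / c0) = c by rewrite mulrC divfK ?gt_eqF.
have -> : x0 * (x / x0) = x by rewrite mulrC divfK ?gt_eqF.
move=> /le_trans; apply.
have E1 : (x0 / c0) `^ al = c0 `^ be * x0 `^ al / c0.
  rewrite powRM ?invr_ge0 ?ltW// -[in LHS]powR_inv1 ?ltW// -powRrM mulN1r.
  have -> : - al = be - 1 by rewrite -ab opprD addrC addrNK.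
  rewrite powRB; last by apply/implyP => _; rewrite gt_eqF.
  rewrite powRr1 ?ltW//; ring.
have E2 : (c0 / x0) `^ be = c0 `^ be * x0 `^ al / x0.
  rewrite powRM ?invr_ge0 ?ltW// -[in LHS]powR_inv1 ?ltW// -powRrM mulN1r.
  have -> : - be = al - 1 by rewrite -ab opprD addrA subrr sub0r.
  rewrite powRB; last by apply/implyP => _; rewrite gt_eqF.
  rewrite powRr1 ?ltW//; ring.
rewrite E1 E2; set K := c0 `^ be * x0 `^ al.
have -> : be = 1 - al by rewrite -ab addrC addKr.
rewrite le_eqVlt; apply/orP; left; apply/eqP.
by field; rewrite !gt_eqF.
Qed.

Lemma powR_tangent al u x : 0 < al < 1 -> 0 < u -> 0 <= x ->
  x `^ al <= u `^ al + (x - u) * (al * u `^ (al - 1)).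
Proof.
move=> /andP[al0 al1] u0 x0.
have := @powR_mul_tangent al (1 - al) 1 u 1 x al0.
rewrite subr_gt0 subrr !mul0r addr0 powR1 !mul1r => /(_ al1) H.
apply: (le_trans (H _ ltr01 u0 ler01 x0)); first by rewrite addrC subrK.
by rewrite -powR_inv1 ?(ltW u0)// -powRrM mulN1r opprB.
Qed.

Lemma powR_jensen al s t x y z : 0 < al < 1 -> 0 <= s -> 0 <= t -> 0 <= x ->
  0 <= y -> 0 < z -> 0 < s + t -> s * x + t * y = (s + t) * z ->
  s * x `^ al + t * y `^ al <= (s + t) * z `^ al.
Proof.
move=> al01 s0 t0 x0 y0 z0 st E.
have := ler_wpM2l s0 (powR_tangent al01 z0 x0).
have := ler_wpM2l t0 (powR_tangent al01 z0 y0).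
set K := al * _.
have EK : s * ((x - z) * K) + t * ((y - z) * K) = 0.
  have -> : s * ((x - z) * K) + t * ((y - z) * K) =
    (s * x + t * y - (s + t) * z) * K by ring.
  by rewrite E subrr mul0r.
by rewrite !mulrDr mulrDl; lra.
Qed.

(** Each chord is compared with the one over [[x, y']], which shares an end point with both; the
    denominators are cleared. *)
Lemma powR_slope_anti r x y x' y' : 0 < r <= 1 -> 0 < x < y -> x' < y' ->
  x <= x' -> y <= y' ->
  (y' `^ r - x' `^ r) * (y - x) <= (y `^ r - x `^ r) * (y' - x').
Proof.
move=> /andP[r0]; rewrite le_eqVlt => /predU1P[-> /andP[x0 xy] x'y' xx' yy'|r1].
  rewrite !powRr1//; lra.
move=> /andP[x0 xy] x'y' xx' yy'.
have r01 : 0 < r < 1 by rewrite r0.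
have H1 : (y' `^ r - x' `^ r) * (y' - x) <= (y' `^ r - x `^ r) * (y' - x').
  have := @powR_jensen r (y' - x') (x' - x) x y' x' r01.
  have -> : y' - x' + (x' - x) = y' - x by lra.
  rewrite !subr_ge0 (ltW x'y') xx' (ltW x0) subr_gt0.
  have y'0 : 0 <= y' by lra.
  have -> : x < y' by lra.
  have x'0 : 0 < x' by lra.
  move=> /(_ erefl erefl erefl y'0 x'0 erefl) H.
  have {H} : (y' - x') * x `^ r + (x' - x) * y' `^ r <= (y' - x) * x' `^ r.
    by apply: H; ring.
  lra.
have H2 : (y' `^ r - x `^ r) * (y - x) <= (y `^ r - x `^ r) * (y' - x).
  have := @powR_jensen r (y' - y) (y - x) x y' y r01.
  have -> : y' - y + (y - x) = y' - x by lra.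
  rewrite !subr_ge0 (ltW xy) yy' (ltW x0) subr_gt0.
  have y'0 : 0 <= y' by lra.
  have -> : x < y' by lra.
  have y0 : 0 < y by lra.
  move=> /(_ erefl erefl erefl y'0 y0 erefl) H.
  have {H} : (y' - y) * x `^ r + (y - x) * y' `^ r <= (y' - x) * y `^ r.
    by apply: H; ring.
  lra.
have y'x : 0 < y' - x by lra.
rewrite -(ler_pM2r y'x).
have a1 : 0 <= y - x by lra.
have a2 : 0 <= y' - x' by lra.
have := ler_wpM2r a1 H1; have := ler_wpM2r a2 H2.
lra.
Qed.

End weighted_amgm.

(** * The weight of a point on a fixed anti-diagonal *)

Section split_weight.
Context {R : realType}.
Variables al be C s : R.
Hypotheses (al0 : 0 < al) (be0 : 0 < be) (ab : al + be = 1).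
Hypotheses (C0 : 0 < C) (s0 : 0 < s).

(* With [al = 1/p], [be = 1/q], [c = a_1^q], [C - c = a_2^q], [x = Y_1^p] and
   [s - x = Y_2^p], this is [a_1 Y_1 + a_2 Y_2]. *)
Definition split_weight (c x : R) : R :=
  c `^ be * x `^ al + (C - c) `^ be * (s - x) `^ al.

Local Notation L := split_weight.

Definition split_weight_dc (c x : R) : R :=
  be * ((x / c) `^ al - ((s - x) / (C - c)) `^ al).

Definition split_weight_dx (c x : R) : R :=
  al * ((c / x) `^ be - ((C - c) / (s - x)) `^ be).

Lemma split_weight_tangent c0 x0 c x : 0 < c0 < C -> 0 < x0 < s ->
  0 <= c <= C -> 0 <= x <= s ->
  L c x <= L c0 x0 + (c - c0) * split_weight_dc c0 x0
                   + (x - x0) * split_weight_dx c0 x0.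
Proof.
move=> /andP[c00 c0C] /andP[x00 x0s] /andP[c1 cC] /andP[x1 xs].
have := powR_mul_tangent al0 be0 ab c00 x00 c1 x1.
have := @powR_mul_tangent _ al be (C - c0) (s - x0) (C - c) (s - x) al0 be0 ab.
rewrite !subr_gt0 !subr_ge0 => /(_ c0C x0s cC xs).
rewrite /L /split_weight_dc /split_weight_dx; lra.
Qed.

Lemma split_weight_concave c x c' x' u v : 0 <= c <= C -> 0 <= c' <= C ->
  0 <= x <= s -> 0 <= x' <= s -> 0 <= u -> 0 <= v -> u + v = 1 ->
  0 < u * c + v * c' < C -> 0 < u * x + v * x' < s ->
  u * L c x + v * L c' x' <= L (u * c + v * c') (u * x + v * x').
Proof.
move=> cC c'C xs x's u0 v0 uv iC ix.
have := ler_wpM2l u0 (split_weight_tangent iC ix cC xs).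
have := ler_wpM2l v0 (split_weight_tangent iC ix c'C x's).
set K := L (u * c + _) _; set D := split_weight_dc _ _.
set E := split_weight_dx _ _.
have -> : v = 1 - u by lra.
lra.
Qed.

(** At [x = c / C * s] the ratios [x / c] and [(s - x) / (C - c)] both equal [s / C], so the two
    terms add up by homogeneity and [c] disappears from the value. *)
Lemma split_weight_peak c : 0 < c < C -> L c (c / C * s) = C `^ be * s `^ al.
Proof.
move=> /andP[c0 cC]; rewrite /L.
have -> : s - c / C * s = (C - c) / C * s by field; rewrite gt_eqF.
have Cc : 0 < C - c by rewrite subr_gt0.
rewrite !powRM ?mulr_ge0 ?divr_ge0 ?invr_ge0 ?(ltW C0) ?(ltW s0) ?(ltW c0)
  ?(ltW Cc)//.
have E : C^-1 `^ al = C `^ be / C.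
  rewrite -[in LHS]powR_inv1 ?(ltW C0)// -powRrM mulN1r.
  have -> : - al = be - 1 by rewrite -ab opprD addrC addrNK.
  rewrite powRB; first by rewrite powRr1 ?ltW.
  by apply/implyP => _; rewrite gt_eqF.
have F x : 0 < x -> x `^ be * x `^ al = x.
  move=> x0; rewrite -powRD; first by rewrite addrC ab powRr1 ?ltW.
  by apply/implyP => _; rewrite gt_eqF.
transitivity ((c `^ be * c `^ al + (C - c) `^ be * (C - c) `^ al) *
  C^-1 `^ al * s `^ al); first by ring.
by rewrite !F// E; field; rewrite gt_eqF.
Qed.

Lemma split_weight_le_peak c x : 0 < c < C -> 0 <= x <= s ->
  L c x <= C `^ be * s `^ al.
Proof.
move=> /andP[c0 cC] xs.
have x0s : 0 < c / C * s < s.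
  rewrite mulr_gt0 ?divr_gt0//= gtr_pMl// ltr_pdivrMr// mul1r//.
have cC' : 0 < c < C by rewrite c0.
have cC'' : 0 <= c <= C by rewrite !ltW.
have := split_weight_tangent cC' x0s cC'' xs.
rewrite split_weight_peak// subrr mul0r addr0 /split_weight_dx.
have -> : c / (c / C * s) = C / s by field; rewrite !gt_eqF.
have -> : (C - c) / (s - c / C * s) = C / s.
  have -> : s - c / C * s = (C - c) * (s / C) by field; rewrite gt_eqF.
  by field; rewrite !gt_eqF// subr_gt0.
by rewrite subrr !mulr0 addr0.
Qed.

(* [x `^ r] is [1] for [x < 0], hence the truncation. *)
Lemma continuous_powR_max0 r : 0 < r ->
  continuous (fun x : R => Num.max x 0 `^ r : R).
Proof.
move=> r0 x; rewrite /continuous_at /=; have [x0|x0|->] := ltgtP x 0.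
- apply: cvg_near_cst.
  near=> y; congr (_ `^ _); apply: max_r; near: y.
  by apply: filterS (lt_nbhsl x0) => y /ltW.
- have E : {near x, (fun y => y `^ r) =1 (fun y => Num.max y 0 `^ r)}.
    near=> y; congr (_ `^ _); apply/esym/max_l; near: y.
    by apply: filterS (lt_nbhsr x0) => y /ltW.
  apply: (cvg_trans (near_eq_cvg E)).
  apply: (@differentiable_continuous _ _ _ _ (fun y : R => y `^ r)).
  apply/derivable1_diffP.
  by apply: derivable_powR; rewrite in_itv/= x0.
- apply/cvgrPdist_lt => e e0; rewrite powR0 ?gt_eqF//.
  near=> y; rewrite sub0r normrN ger0_norm ?powR_ge0//.
  have [y0|y0] := leP y 0; first by rewrite powR0 ?gt_eqF.
  have -> : e = (e `^ r^-1) `^ r.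
    by rewrite -powRrM mulVf ?gt_eqF// powRr1// ltW.
  apply: gt0_ltr_powR; rewrite ?nnegrE ?powR_ge0 ?(ltW y0)//.
  by near: y; apply: lt_nbhsl; rewrite powR_gt0.
Unshelve. all: by end_near. Qed.

Lemma split_weight_ivt c lo hi v : 0 <= lo -> lo <= hi -> hi <= s ->
  Num.min (L c lo) (L c hi) <= v <= Num.max (L c lo) (L c hi) ->
  exists2 x : R, lo <= x <= hi & L c x = v.
Proof.
move=> lo0 lohi his.
pose f (x : R) : R := c `^ be * Num.max x 0 `^ al
                    + (C - c) `^ be * Num.max (s - x) 0 `^ al.
have fE x : lo <= x <= hi -> f x = L c x.
  by move=> /andP[lox xhi]; rewrite /f !max_l//; lra.
rewrite -!fE ?lexx ?lohi//.
move=> /IVT -/(_ lohi)[|x].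
  apply: continuous_subspaceT => x; apply: cvgD.
    by apply: cvgM; [exact: cvg_cst|exact: continuous_powR_max0].
  apply: cvgM; first exact: cvg_cst.
  apply: (@continuous_comp _ _ _ (fun y => s - y) (fun y => Num.max y 0 `^ al)).
    by apply: cvgB; [exact: cvg_cst|exact: cvg_id].
  exact: continuous_powR_max0.
by rewrite in_itv/= => xlh <-; exists x => //; rewrite fE.
Qed.

Lemma split_weight0 c : L c 0 = (C - c) `^ be * s `^ al.
Proof. by rewrite /L powR0 ?gt_eqF// mulr0 add0r subr0. Qed.

Lemma split_weights c : L c s = c `^ be * s `^ al.
Proof. by rewrite /L subrr powR0 ?gt_eqF// mulr0 addr0. Qed.

(** Concavity in [x], with one end value allowed to equal [t]: this is what is known at an end point
    of the superlevel interval, while the other value is strict at the peak. *)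
Lemma split_weight_gt_between c x y z t : 0 < c < C -> 0 <= x <= s ->
  0 <= z <= s -> x < y < z ->
  (t <= L c x /\ t < L c z \/ t < L c x /\ t <= L c z) -> t < L c y.
Proof.
move=> /[dup] /andP[c0 cC] c0C xs zs /andP[xy yz] H.
have zx : 0 < z - x by lra.
pose u := (z - y) / (z - x); pose v := (y - x) / (z - x).
have u0 : 0 < u by apply: divr_gt0 => //; lra.
have v0 : 0 < v by apply: divr_gt0 => //; lra.
have uv : u + v = 1 by rewrite /u /v; field; rewrite gt_eqF.
have yE : u * x + v * z = y by rewrite /u /v; field; rewrite gt_eqF.
have cE : u * c + v * c = c by rewrite -mulrDl uv mul1r.
have cc : 0 <= c <= C by rewrite !ltW.
have := split_weight_concave cc cc xs zs (ltW u0) (ltW v0) uv.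
rewrite cE yE => /(_ c0C) H2.
have /H2 : 0 < y < s by apply/andP; split; lra.
apply: lt_le_trans.
have -> : t = u * t + v * t by rewrite -mulrDl uv mul1r.
case: H => -[H H'].
  by apply: ler_ltD; rewrite ?ltr_pM2l// ler_wpM2l// ltW.
by apply: ltr_leD; rewrite ?ltr_pM2l// ler_wpM2l// ltW.
Qed.

End split_weight.

Lemma powR_lt (R : realType) (r x y : R) : 0 < r -> 0 <= x -> x < y ->
  x `^ r < y `^ r.
Proof.
move=> r0 x0 xy; apply: gt0_ltr_powR; rewrite ?nnegrE//.
exact: le_trans (ltW xy).
Qed.

Lemma powRN_lt (R : realType) (r x y : R) : 0 < r -> 0 < x -> x < y ->
  y `^ (- r) < x `^ (- r).
Proof.
move=> r0 x0 xy; have y0 := lt_trans x0 xy.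
by rewrite !powRN ltf_pV2 ?posrE ?powR_gt0// powR_lt// ltW.
Qed.

(** * Weighted speed of an end point as a chord slope *)

Section kernel.
Context {R : realType}.
Variables al be : R.
Hypotheses (al0 : 0 < al) (be0 : 0 < be).
Local Notation m := (Num.min al be).

(** Up to factors common to both ends of the superlevel interval, this is the weight at an end point
    times the speed of that end point. The arguments are its ratios [x / c] and [(s - x) / (C - c)],
    the smaller one first. *)
Definition slope_kernel (x y : R) : R :=
  (x * y) `^ (- m) * ((y `^ al - x `^ al) / (x `^ (- be) - y `^ (- be))).

(** If [be <= al], the kernel is the inverse of a chord slope of [z^(be/al)] between points
    [z = x^al]. Otherwise it is a chord slope of [z^(al/be)] between points [z = x^(-be)], which
    move left as [x] grows. Both powers are concave, so [powR_slope_anti] decides either case. *)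
Lemma slope_kernel_mono x y x' y' : 0 < x < y -> 0 < x' < y' ->
  x <= x' -> y <= y' -> slope_kernel x y <= slope_kernel x' y'.
Proof.
rewrite /slope_kernel.
case: (leP be al) => [ba|/ltW ba] h h' xx yy.
  have E a b : 0 < a < b ->
      (a * b) `^ (- be) * ((b `^ al - a `^ al) / (a `^ (- be) - b `^ (- be))) =
      (b `^ al - a `^ al) / (b `^ be - a `^ be).
    move=> /andP[a0 lt_ab]; have b0 := lt_trans a0 lt_ab.
    rewrite !powRN powRM ?ltW//.
    have := powR_lt be0 (ltW a0) lt_ab.
    move=> ?; field; rewrite !gt_eqF ?powR_gt0 ?subr_gt0//.
  rewrite !E//.
  move: h h' => /andP[x0 xy] /andP[x'0 x'y'].
  have y0 := lt_trans x0 xy; have y'0 := lt_trans x'0 x'y'.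
  rewrite ler_pdivrMr ?subr_gt0 ?powR_lt ?(ltW x0)// mulrAC.
  rewrite ler_pdivlMr ?subr_gt0 ?powR_lt ?(ltW x'0)//.
  have := @powR_slope_anti R (be / al) (x `^ al) (y `^ al) (x' `^ al) (y' `^ al).
  have K z : (z `^ al) `^ (be / al) = z `^ be.
    by rewrite -powRrM mulrCA divff ?mulr1 ?gt_eqF.
  rewrite !K divr_gt0// ler_pdivrMr// mul1r ba powR_gt0//.
  rewrite !powR_lt ?(ltW x0) ?(ltW x'0)// => /(_ erefl erefl erefl) H.
  rewrite mulrC; apply: le_trans (H _ _) _; last by rewrite mulrC.
  - by apply: ge0_ler_powR => //; rewrite ?nnegrE ltW.
  - by apply: ge0_ler_powR => //; rewrite ?nnegrE ltW.
have E a b : 0 < a < b ->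
    (a * b) `^ (- al) * ((b `^ al - a `^ al) / (a `^ (- be) - b `^ (- be))) =
    (a `^ (- al) - b `^ (- al)) / (a `^ (- be) - b `^ (- be)).
  move=> /andP[a0 lt_ab]; have b0 := lt_trans a0 lt_ab.
  rewrite mulrA; congr (_ / _); rewrite !powRN powRM ?ltW//.
  by field; rewrite !gt_eqF ?powR_gt0.
rewrite !E//.
move: h h' => /andP[x0 xy] /andP[x'0 x'y'].
have y0 := lt_trans x0 xy; have y'0 := lt_trans x'0 x'y'.
rewrite ler_pdivrMr ?subr_gt0 ?powRN_lt// mulrAC.
rewrite ler_pdivlMr ?subr_gt0 ?powRN_lt//.
have := @powR_slope_anti R (al / be) (y' `^ (- be)) (x' `^ (- be))
  (y `^ (- be)) (x `^ (- be)).
have K z : (z `^ (- be)) `^ (al / be) = z `^ (- al).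
  by rewrite -powRrM mulNr mulrCA divff ?mulr1 ?gt_eqF.
rewrite !K divr_gt0// ler_pdivrMr// mul1r ba powR_gt0//.
rewrite !powRN_lt// => /(_ erefl erefl erefl); apply.
- by rewrite !powRN lef_pV2 ?posrE ?powR_gt0// ge0_ler_powR// ?nnegrE ltW.
- by rewrite !powRN lef_pV2 ?posrE ?powR_gt0// ge0_ler_powR// ?nnegrE ltW.
Qed.

End kernel.

(** * End points of superlevel intervals and their speeds *)

Section level_set.
Context {R : realType}.
Variables al be C s : R.
Hypotheses (al0 : 0 < al) (be0 : 0 < be) (ab : al + be = 1).
Hypotheses (C0 : 0 < C) (s0 : 0 < s).
Local Notation L := (split_weight al be C s).
Local Notation m := (Num.min al be).

(* Applied at both end points of a superlevel interval, this orders the ratios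
   [x / c] and [(s - x) / (C - c)] of one end point against those of the other. *)
Lemma split_weight_dual_le c x : C / 2 <= c < C -> 0 < x < s ->
  c * ((s - x) / (C - c)) <= s ->
  L c (c * ((s - x) / (C - c))) <= L c x.
Proof.
move=> /andP[Cc cC] /andP[x0 xs]; set w := (s - x) / (C - c) => cws.
have c0 : 0 < c by lra.
have Cc0 : 0 < C - c by lra.
have w0 : 0 < w by rewrite divr_gt0 ?subr_gt0.
(* As [al + be = 1], [L] is a weighted sum of the [al]-th powers of the two ratios, with weights [c]
   and [C - c]. *)
have E (d y : R) : 0 < d -> 0 <= y -> d `^ be * (d * y) `^ al = d * y `^ al.
  move=> d0 y0; rewrite powRM ?(ltW d0)// mulrA -powRD.
    by rewrite (addrC be) ab powRr1// ltW.
  by apply/implyP => _; rewrite gt_eqF.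
rewrite /split_weight E ?(ltW w0)//.
pose w4 := (s - c * w) / (C - c); pose u := x / c.
have w40 : 0 <= w4 by rewrite divr_ge0 ?(ltW Cc0)// subr_ge0.
have u0 : 0 < u by rewrite divr_gt0.
have -> : s - c * w = (C - c) * w4 by rewrite /w4; field; rewrite gt_eqF.
have -> : s - x = (C - c) * w by rewrite /w; field; rewrite gt_eqF.
rewrite [in leRHS](_ : x = c * u); last by rewrite /u mulrC divfK ?gt_eqF.
rewrite !E ?(ltW w0) ?(ltW u0)//.
have al01 : 0 < al < 1 by rewrite al0 -ab ltrDl.
(* This is where [C / 2 <= c] enters. After cancelling [(C - c) * w^al], the claim is Jensen's
   inequality for [w] and [w4], with weights [2 * c - C] and [C - c] and mean [u]. *)
have c2 : 0 <= 2 * c - C by lra.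
have := powR_jensen al01 c2 (ltW Cc0) (ltW w0) w40 u0.
have -> : 2 * c - C + (C - c) = c by lra.
move=> /(_ c0); have -> : (2 * c - C) * w + (C - c) * w4 = c * u.
  by rewrite /u /w4 /w; field; rewrite !gt_eqF.
move=> /(_ erefl); lra.
Qed.

Lemma split_weight_reflect_le c x : C / 2 <= c < C -> 0 <= x -> x <= s - x ->
  L c x <= L c (s - x).
Proof.
move=> /andP[Cc cC] x0 xs; rewrite /split_weight subKr -subr_ge0.
have -> : c `^ be * (s - x) `^ al + (C - c) `^ be * x `^ al -
  (c `^ be * x `^ al + (C - c) `^ be * (s - x) `^ al) =
  (c `^ be - (C - c) `^ be) * ((s - x) `^ al - x `^ al) by ring.
apply: mulr_ge0; rewrite subr_ge0; apply: ge0_ler_powR;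
  by rewrite ?nnegrE ?(ltW al0) ?(ltW be0)//; lra.
Qed.

(* [sa] and [sb] are the slopes of the level curve [L = t] at [(c, a)] and
   [(c, b)]. *)
Lemma split_weight_level_set c t : C / 2 <= c < C ->
  c `^ be * s `^ al < t < C `^ be * s `^ al ->
  exists a b sa sb : R,
    [/\ [/\ 0 < a, a < b, b < s & s <= a + b],
        (forall x : R, a < x < b -> t < L c x),
        [/\ 0 < sa, 0 < sb &
          (b * (s - b)) `^ (- m) * sb <= (a * (s - a)) `^ (- m) * sa] &
        forall c1 x : R, c <= c1 <= C -> 0 <= x <= s -> t < L c1 x ->
          a + sa * (c1 - c) < x < b + sb * (c1 - c)].
Proof.
move=> cC /andP[ct tC]; have [Cc2 ltcC] := andP cC.
have c0 : 0 < c by lra.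
have Cc0 : 0 < C - c by lra.
have cC' : 0 < c < C by rewrite c0.
set z : R := c / C * s.
have z0 : 0 < z by rewrite mulr_gt0 ?divr_gt0.
have zs : z < s by rewrite gtr_pMl// ltr_pdivrMr// mul1r.
have Lz : L c z = C `^ be * s `^ al by exact: split_weight_peak.
have L0 : L c 0 < t.
  rewrite split_weight0//; apply: le_lt_trans ct.
  rewrite ler_wpM2r ?powR_ge0// ge0_ler_powR ?nnegrE ?(ltW be0) ?(ltW c0)
    ?(ltW Cc0)//.
  lra.
have Ls : L c s < t by rewrite split_weights.
have [a /andP[a0 az] La] : exists2 x : R, 0 <= x <= z & L c x = t.
  apply: split_weight_ivt; rewrite ?(ltW z0) ?(ltW zs)//.
  by rewrite ge_min le_max (ltW L0)/= Lz (ltW tC) orbT.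
have [b /andP[zb bs] Lb] : exists2 x : R, z <= x <= s & L c x = t.
  apply: split_weight_ivt; rewrite ?(ltW z0) ?(ltW zs)//.
  by rewrite ge_min le_max (ltW Ls)/= Lz (ltW tC) orbT.
have {}a0 : 0 < a.
  by rewrite lt_neqAle a0 andbT; apply: contraTN L0 => /eqP ->; rewrite La ltxx.
have {}az : a < z.
  rewrite lt_neqAle az andbT; apply: contraTN tC => /eqP az'.
  by rewrite -Lz -az' La ltxx.
have {}zb : z < b.
  rewrite lt_neqAle zb andbT; apply: contraTN tC => /eqP az'.
  by rewrite -Lz az' Lb ltxx.
have {}bs : b < s.
  rewrite lt_neqAle bs andbT; apply: contraTN Ls => /eqP E.
  by rewrite -{2}E Lb ltxx.
have ltab : a < b by exact: lt_trans zb.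
have tLz : t < L c z by rewrite Lz.
have zin : 0 <= z <= s by rewrite !ltW.
have ain : 0 <= a <= s by rewrite (ltW a0) (ltW (lt_trans ltab bs)).
have bin : 0 <= b <= s by rewrite (ltW bs) (ltW (lt_trans a0 ltab)).
have Hin x : a < x < b -> t < L c x.
  move=> /andP[ax xb]; have [xz|zx|->//] := ltgtP x z.
    apply: (split_weight_gt_between al0 be0 ab cC' ain zin).
      by rewrite ax.
    by left; rewrite La lexx.
  apply: (split_weight_gt_between al0 be0 ab cC' zin bin).
    by rewrite zx.
  by right; rewrite Lb lexx.
pose u (x : R) : R := x / c; pose v (x : R) : R := (s - x) / (C - c).
(* A dual point strictly inside []a, b[] would have a value above [t], against
   [split_weight_dual_le]. *)
have dual x : 0 < x < s -> L c x = t -> (c * v x <= a) || (b <= c * v x).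
  move=> xs Lx; rewrite -[X in X || _]negbK -implybE -ltNge; apply/implyP => acv.
  rewrite leNgt; apply/negP => cvb.
  have cvs : c * v x <= s by exact: ltW (lt_trans cvb bs).
  have := split_weight_dual_le cC xs cvs.
  by rewrite leNgt Lx Hin// acv.
have uvb : v b < u b.
  rewrite /u /v ltr_pdivrMr// mulrAC ltr_pdivlMr//.
  move: zb; rewrite /z mulrAC ltr_pdivrMr//; lra.
have uva : u a < v a.
  rewrite /u /v ltr_pdivlMr// mulrAC ltr_pdivrMr//.
  move: az; rewrite /z mulrAC ltr_pdivlMr//; lra.
have cu x : c * u x = x by rewrite /u mulrC divfK ?gt_eqF.
have a_in : 0 < a < s by rewrite a0 (lt_trans ltab).
have b_in : 0 < b < s by rewrite bs (lt_trans a0).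
(* Since [c * u x = x], the other alternative of [dual] would reverse the order of the two ratios,
   which is fixed by the side of the peak. *)
have vu : v b <= u a.
  rewrite -(ler_pM2l c0) cu.
  have /orP[//|] := dual b b_in Lb.
  by rewrite -[X in X <= _](cu b) ler_pM2l// leNgt uvb.
have uv : u b <= v a.
  rewrite -(ler_pM2l c0) cu.
  have /orP[|//] := dual a a_in La.
  by rewrite -[X in _ <= X](cu a) ler_pM2l// leNgt uva.
have ua0 : 0 < u a by rewrite divr_gt0.
have vb0 : 0 < v b by rewrite divr_gt0// subr_gt0.
have va0 : 0 < v a by exact: lt_trans uva.
have ub0 : 0 < u b by exact: lt_trans uvb.
pose r : R := be / al.
have r0 : 0 < r by exact: divr_gt0.
(* Speed of an end point by implicit differentiation, minus the [c]-slope of [L] over its [x]-slope.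
   The smaller ratio comes first: [u] at [a], [v] at [b]. *)
pose S (x y : R) : R := r * ((y `^ al - x `^ al) / (x `^ (- be) - y `^ (- be))).
have S0 x y : 0 < x -> x < y -> 0 < S x y.
  move=> x0 xy; apply: mulr_gt0 => //.
  apply: divr_gt0; rewrite subr_gt0; last exact: powRN_lt.
  by apply: powR_lt => //; exact: ltW.
have dxE x : 0 < x < s ->
    split_weight_dx al be C s c x = al * (u x `^ (- be) - v x `^ (- be)).
  move=> /andP[x0 xs]; rewrite /split_weight_dx /u /v.
  have K (d y : R) : 0 < d -> 0 < y -> (d / y) `^ be = (y / d) `^ (- be).
    move=> d0 y0; rewrite -[d / y]invrK invf_div -powR_inv1 ?divr_ge0 ?ltW//.
    by rewrite -powRrM mulN1r.
  by rewrite !K// subr_gt0.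
have kE x : 0 < x < s ->
    (x * (s - x)) `^ (- m) = (c * (C - c)) `^ (- m) * (u x * v x) `^ (- m).
  move=> /andP[x0 xs]; rewrite -powRM.
  - by congr (_ `^ _); rewrite /u /v; field; rewrite !gt_eqF.
  - by rewrite mulr_ge0 ?ltW.
  - by rewrite mulr_ge0 ?divr_ge0 ?subr_ge0 ?ltW.
exists a, b, (S (u a) (v a)), (S (v b) (u b)).
split; [split|exact: Hin|split|] => //.
(* If [a + b < s], then [b] lies strictly between the peak and [s - a]. By reflection [L] is at
   least [t] at [s - a], so it would exceed [t] at [b]. *)
- rewrite leNgt; apply/negP => abs.
  have sain : 0 <= s - a <= s.
    by rewrite subr_ge0 (ltW (lt_trans ltab bs)) gerBl ltW.
  have : t < L c b.
    apply: (split_weight_gt_between al0 be0 ab cC' zin sain (y := b)).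
      by rewrite zb ltrBrDl.
    right; split => //; rewrite -La; apply: split_weight_reflect_le => //.
      exact: ltW.
    by rewrite lerBrDr (le_trans _ (ltW abs))// lerD2l ltW.
  by rewrite Lb ltxx.
- exact: S0.
- exact: S0.
- rewrite !kE// /S.
  have := @slope_kernel_mono R al be al0 be0 (v b) (u b) (u a) (v a).
  rewrite vb0 uvb ua0 uva vu uv => /(_ erefl erefl erefl erefl).
  have K0 : 0 <= (c * (C - c)) `^ (- m) * r.
    by rewrite mulr_ge0 ?powR_ge0// ltW.
  move=> /(ler_wpM2l K0); rewrite /slope_kernel (mulrC (u b) (v b)).
  by rewrite 2!(mulrACA _ r).
(* The tangent plane at each end point bounds [L c1 x] from above. Its [x]-slope is positive at [a]
   and negative at [b], hence a lower and an upper bound for [x]. *)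
- move=> c1 x /andP[cc1 c1C] xs tL.
  have c1in : 0 <= c1 <= C by rewrite c1C (le_trans (ltW c0)).
  apply/andP; split.
  + have := split_weight_tangent al0 be0 ab cC' a_in c1in xs.
    rewrite La dxE// /split_weight_dc -/(u a) -/(v a) => H.
    have P : 0 < u a `^ (- be) - v a `^ (- be) by rewrite subr_gt0 powRN_lt.
    have Q : 0 < al * (u a `^ (- be) - v a `^ (- be)) by rewrite mulr_gt0.
    rewrite -ltrBrDl -(ltr_pM2r Q).
    have -> : S (u a) (v a) * (c1 - c) * (al * (u a `^ (- be) - v a `^ (- be)))
      = be * (v a `^ al - u a `^ al) * (c1 - c).
      by rewrite /S /r; field; rewrite !gt_eqF.
    lra.
  + have := split_weight_tangent al0 be0 ab cC' b_in c1in xs.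
    rewrite Lb dxE// /split_weight_dc -/(u b) -/(v b) => H.
    have P : 0 < v b `^ (- be) - u b `^ (- be) by rewrite subr_gt0 powRN_lt.
    have Q : 0 < al * (v b `^ (- be) - u b `^ (- be)) by rewrite mulr_gt0.
    rewrite -ltrBlDl -(ltr_pM2r Q).
    have -> : S (v b) (u b) * (c1 - c) * (al * (v b `^ (- be) - u b `^ (- be)))
      = be * (u b `^ al - v b `^ al) * (c1 - c).
      by rewrite /S /r; field; rewrite !gt_eqF.
    lra.
Qed.

End level_set.

(** * Monotonicity of the mass of superlevel sets *)

(** Take the supremum [c] of the points up to which [P] holds without gap: the left clause gives
    [P c], and the right clause excludes [c < b]. *)
Lemma real_interval_ind (R : realType) (P : R -> Prop) (a b : R) : a <= b ->
  P a ->
  (forall x, a < x <= b -> (forall y, a <= y < x -> P y) -> P x) ->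
  (forall x, a <= x < b -> P x ->
    exists2 e, 0 < e & forall y, x < y < x + e -> y <= b -> P y) ->
  P b.
Proof.
move=> leab Pa Pleft Pright.
pose A : set R := [set x | a <= x <= b /\ forall y, a <= y <= x -> P y].
have Aa : A a.
  split=> [|y]; first by rewrite lexx.
  by rewrite -eq_le => /eqP <-.
have Aub : ubound A b by move=> x [/andP[]].
have Asup : has_sup A by split; [exists a|exists b].
pose c := sup A.
have ac : a <= c by apply: sup_upper_bound.
have cb : c <= b by apply: ge_sup => //; exists a.
have Pltc y : a <= y < c -> P y.
  move=> /andP[ay yc]; have [|x [_ Ax] yx] := @sup_gt R A y _ yc.
    by exists a.
  by apply: Ax; rewrite ay ltW.
have Pc : P c.
  move: ac; rewrite le_eqVlt => /predU1P[<-//|ac].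
  by apply: Pleft => //; rewrite ac.
move: cb; rewrite le_eqVlt => /predU1P[<-//|cb].
have [e e0 He] := Pright c (introT andP (conj ac cb)) Pc.
pose d := Num.min b (c + e / 2).
have cd : c < d by rewrite lt_min cb; lra.
have db : d <= b by rewrite ge_min lexx.
have dce : d <= c + e / 2 by rewrite ge_min lexx orbT.
suff : A d by move=> /(sup_upper_bound Asup); rewrite leNgt -/c cd.
split; first by rewrite db andbT (le_trans ac)// ltW.
move=> y /andP[ay yd]; have [yc|yc] := ltP y c; first by apply: Pltc; rewrite ay.
move: yc; rewrite le_eqVlt => /predU1P[<-//|yc].
apply: He; last exact: le_trans db.
by rewrite yc; lra.
Qed.

Section shift_interval.
Context {R : realType}.
Local Notation mu := (@lebesgue_measure R).

(** The part []a', b[] is common to both intervals. What remains is the mass gained on [[b, b'[], at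
    most [kb * (b' - b)], against the mass lost on []a, a']], at least [ka * (a' - a)]. *)
Lemma integral_itv_shift_le (w : R -> R) (s a b a' b' ka kb e : R) :
  measurable_fun `]0, s[ w -> (forall x, 0 < x < s -> 0 <= w x) ->
  0 < a -> a <= a' -> a' < b -> b <= b' -> b' <= s -> 0 <= ka -> 0 <= kb ->
  (forall x, a < x <= a' -> ka <= w x) ->
  (forall x, b <= x < b' -> w x <= kb) ->
  kb * (b' - b) <= ka * (a' - a) + e -> 0 <= e ->
  (\int[mu]_(x in `]a', b'[) (w x)%:E <=
   \int[mu]_(x in `]a, b[) (w x)%:E + e%:E)%E.
Proof.
move=> mw w0 a0 aa' a'b bb' b's ka0 kb0 wka wkb H e0.
have ms (D : set R) : measurable D -> D `<=` `]0, s[ ->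
    measurable_fun D (EFin \o w).
  by move=> mD Ds; apply/measurable_EFinP; apply: measurable_funS mw.
have sub (x y : itv_bound R) : (BRight 0 <= x)%O -> (y <= BLeft s)%O ->
    [set` Interval x y] `<=` (`]0, s[ : set R).
  by move=> h1 h2; apply: subitvP; rewrite subitvE h1.
have U1 : `]a', b'[%classic = `]a', b[ `|` `[b, b'[ :> set R.
  by rewrite -itv_bndbnd_setU// ?bnd_simp ?ltW.
have U2 : `]a, b[%classic = `]a, a'] `|` `]a', b[ :> set R.
  by rewrite -itv_bndbnd_setU// bnd_simp ?ltW.
have pos (D : set R) : D `<=` `]0, s[ -> forall x, D x -> (0 <= (w x)%:E)%E.
  by move=> Ds x /Ds /=; rewrite in_itv/= lee_fin => /w0.
rewrite U1 U2 !ge0_integral_setU//; last 6 first.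
- by rewrite -U2; apply: ms => //; apply: sub; rewrite bnd_simp; lra.
- by rewrite -U2; apply: pos; apply: sub; rewrite bnd_simp; lra.
- by apply/disj_set2P; rewrite -subset0 => x []/=; rewrite !in_itv/=; lra.
- by rewrite -U1; apply: ms => //; apply: sub; rewrite bnd_simp; lra.
- by rewrite -U1; apply: pos; apply: sub; rewrite bnd_simp; lra.
- by apply/disj_set2P; rewrite -subset0 => x []/=; rewrite !in_itv/=; lra.
rewrite [leRHS]addeAC addeC leeD2r//.
have I1 : (\int[mu]_(x in `[b, b'[) (w x)%:E <= (kb * (b' - b))%:E)%E.
  have : (\int[mu]_(x in `[b, b'[) (w x)%:E <=
          \int[mu]_(x in `[b, b'[) (cst kb%:E) x)%E.
    apply: ge0_le_integral => //.
    - by apply: pos; apply: sub; rewrite bnd_simp; lra.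
    - by apply: ms => //; apply: sub; rewrite bnd_simp; lra.
  move=> /le_trans; apply; rewrite integral_cst//= lebesgue_measure_itv/= lte_fin.
  by case: ltP => _; rewrite ?mule0 ?EFinM ?EFinB// lee_fin mulr_ge0 ?subr_ge0.
have I2 : ((ka * (a' - a))%:E <= \int[mu]_(x in `]a, a']) (w x)%:E)%E.
  have : (\int[mu]_(x in `]a, a']) (cst ka%:E) x <=
          \int[mu]_(x in `]a, a']) (w x)%:E)%E.
    apply: ge0_le_integral => //.
    - by apply: ms => //; apply: sub; rewrite bnd_simp; lra.
  apply: le_trans; rewrite integral_cst//= lebesgue_measure_itv/= lte_fin.
  move: aa'; rewrite le_eqVlt => /predU1P[->|aa'].
    by rewrite ltxx mule0 subrr mulr0.
  by rewrite aa' EFinM EFinB.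
apply: (le_trans I1); apply: (@le_trans _ _ ((ka * (a' - a))%:E + e%:E)%E).
  by rewrite -EFinD lee_fin.
by rewrite leeD2r.
Qed.

End shift_interval.

Lemma continuous_powR (R : realType) (r x : R) : 0 < x ->
  {for x, continuous (fun y : R => y `^ r)}.
Proof.
move=> x0; apply: (@differentiable_continuous _ _ _ _ (fun y : R => y `^ r)).
by apply/derivable1_diffP; apply: derivable_powR; rewrite in_itv/= x0.
Qed.

Section superlevel.
Context {R : realType}.
Variables al be C s t : R.
Hypotheses (al0 : 0 < al) (be0 : 0 < be) (ab : al + be = 1).
Hypotheses (C0 : 0 < C) (s0 : 0 < s).
Local Notation L := (split_weight al be C s).
Local Notation m := (Num.min al be).
Local Notation mu := (@lebesgue_measure R).

Definition superlevel (c : R) : set R := [set x | 0 < x < s /\ t < L c x].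

Lemma measurable_split_weight c : measurable_fun [set: R] (L c).
Proof.
apply: measurable_funD; apply: measurable_funM => //.
apply: (@measurableT_comp _ _ _ _ _ _ _ _ _ (@measurable_powR R al)).
exact: measurable_funB.
Qed.

Lemma measurable_superlevel c : measurable (superlevel c).
Proof.
rewrite (_ : superlevel c =
    `]0, s[ `&` (setT `&` (fun x => t < L c x) @^-1` [set true])).
  apply: measurableI => //.
  by apply: measurable_fun_ltr => //; exact: measurable_split_weight.
rewrite setTI; apply/seteqP; split => x /=; rewrite in_itv/=.
  by move=> [xs tx]; split.
by move=> [xs tx]; split.
Qed.

Lemma superlevel_sub c : superlevel c `<=` `]0, s[.
Proof. by move=> x [xs _]; rewrite /= in_itv. Qed.

Lemma superlevel_empty c : 0 < c < C -> C `^ be * s `^ al <= t ->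
  superlevel c = set0.
Proof.
move=> cC tC; rewrite -subset0 => x [/andP[x0 xs]].
rewrite ltNge => /negP; apply; apply: le_trans tC.
by apply: split_weight_le_peak => //; rewrite !ltW.
Qed.

(** This is the regime where the value at [x = s] is at least [t]. Right of the peak, [L c] exceeds
    [t] by concavity in [x] between the peak and [s]; left of it, concavity in [c] at fixed [x] is
    used. *)
Lemma superlevel_anti (c c' : R) : 0 < c -> c <= c' -> c' < C ->
  t < C `^ be * s `^ al -> t <= c `^ be * s `^ al ->
  superlevel c' `<=` superlevel c.
Proof.
move=> c0; rewrite le_eqVlt => /predU1P[<- _ _ _ x//|cc'] c'C tC tc x [xs tx].
split => //; have [x0 ltxs] := andP xs.
have cC : 0 < c < C by rewrite c0 (lt_trans cc').
set z : R := c / C * s.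
have z0 : 0 < z by rewrite mulr_gt0 ?divr_gt0.
have zs : z < s by rewrite gtr_pMl// ltr_pdivrMr// mul1r; case/andP: cC.
have Lz : L c z = C `^ be * s `^ al by exact: split_weight_peak.
have [->|xz] := eqVneq x z; first by rewrite Lz.
have [xltz|zx] := ltP x z; last first.
  apply: (@split_weight_gt_between _ al be C s al0 be0 ab c z x s) => //.
  - by rewrite (ltW z0) ltW.
  - by rewrite lexx ltW.
  - by rewrite ltxs andbT lt_neqAle eq_sym xz.
  - by right; rewrite Lz split_weights.
(* The coefficient for which [x] is the peak: [L c1 x] is the maximum, hence above [t], and [c] lies
   between [c1] and [c']. *)
pose c1 := C * x / s.
have c10 : 0 < c1 by rewrite divr_gt0 ?mulr_gt0.
have c1c : c1 < c.
  by move: xltz; rewrite /z /c1 ltr_pdivrMr// mulrAC ltr_pdivlMr// (mulrC C).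
have Lc1 : L c1 x = C `^ be * s `^ al.
  rewrite -(@split_weight_peak _ al be C s ab C0 s0 c1).
    by congr (L _ _); rewrite /c1; field; rewrite !gt_eqF.
  by rewrite c10 (lt_trans c1c)//; case/andP: cC.
have c'c1 : 0 < c' - c1 by lra.
pose u := (c' - c) / (c' - c1); pose v := (c - c1) / (c' - c1).
have u0 : 0 < u by apply: divr_gt0 => //; lra.
have v0 : 0 < v by apply: divr_gt0 => //; lra.
have uv : u + v = 1 by rewrite /u /v; field; rewrite gt_eqF.
have cE : u * c1 + v * c' = c by rewrite /u /v; field; rewrite gt_eqF.
have xE : u * x + v * x = x by rewrite -mulrDl uv mul1r.
have c1C : 0 <= c1 <= C by apply/andP; split; lra.
have c'C' : 0 <= c' <= C by apply/andP; split; lra.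
have xs' : 0 <= x <= s by rewrite !ltW.
have := split_weight_concave al0 be0 ab c1C c'C' xs' xs' (ltW u0) (ltW v0) uv.
rewrite cE xE => /(_ cC xs); apply: lt_le_trans.
have -> : t = u * t + v * t by rewrite -mulrDl uv mul1r.
by apply: ltrD; rewrite ltr_pM2l// Lc1.
Qed.

(** By continuity of [L] in [c] and strictness of [t < L c x], each point of [superlevel c] lies in
    [superlevel (v n)] for all large [n], where [v n] tends to [c] from below. Monotone convergence
    along the increasing sets [F n] concludes. *)
Lemma superlevel_left_limit (w : R -> \bar R) (c0 c : R) (B : \bar R) :
  measurable_fun `]0, s[ w -> (forall x, 0 < x < s -> (0 <= w x)%E) ->
  0 < c0 -> c0 < c -> c < C ->
  (forall v, c0 <= v < c -> (\int[mu]_(x in superlevel v) w x <= B)%E) ->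
  (\int[mu]_(x in superlevel c) w x <= B)%E.
Proof.
move=> mw w0 c00 c0c cC HB.
pose v (n : nat) := c - (c - c0) / n.+1%:R.
have vc n : c0 <= v n < c.
  rewrite /v ltrBlDr ltrDl divr_gt0 ?subr_gt0// andbT lerBrDr -lerBrDl.
  by rewrite ler_pdivrMr ?ltr0n// ler_peMr ?subr_ge0 ?(ltW c0c)// ler1n.
pose F (n : nat) := \bigcap_(k in [set k | (n <= k)%N]) superlevel (v k).
have mF n : measurable (F n).
  apply: bigcap_measurable => [|k _]; first by exists n => /=.
  exact: measurable_superlevel.
have Fs n : F n `<=` `]0, s[.
  by move=> x Fx; apply: (@superlevel_sub (v n)); apply: Fx => /=.
have ms D : measurable D -> D `<=` `]0, s[ -> measurable_fun D w.
  by move=> mD Ds; exact: (measurable_funS (measurable_itv _) Ds mw).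
have pos D : D `<=` `]0, s[ -> forall x, D x -> (0 <= w x)%E.
  by move=> Ds x /Ds /=; rewrite in_itv/=; exact: w0.
have ndF : nondecreasing_seq F.
  move=> n k nk; rewrite subsetEset => x Fx j /= kj; apply: Fx => /=.
  exact: leq_trans kj.
have mU : measurable (\bigcup_n F n) by exact: bigcupT_measurable.
have Us : \bigcup_n F n `<=` `]0, s[ by move=> x [n _ /Fs].
apply: (@le_trans _ _ (\int[mu]_(x in \bigcup_n F n) w x)%E).
  apply: ge0_subset_integral => //;
    [exact: measurable_superlevel|exact: ms|exact: pos|].
  move=> x [xs tx].
  have cv : (fun c => L c x) y @[y --> c] --> L c x.
    have c_gt0 : 0 < c by lra.
    apply: cvgD; apply: cvgM; try exact: cvg_cst.
      exact: continuous_powR.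
    apply: (@continuous_comp _ _ _ (fun y => C - y) (fun y => y `^ be)).
      by apply: cvgB; [exact: cvg_cst|exact: cvg_id].
    by apply: continuous_powR; rewrite subr_gt0.
  have cvv : v n @[n --> \oo] --> c.
    rewrite -[X in _ --> X]subr0; apply: cvgB; first exact: cvg_cst.
    rewrite -[X in _ --> X](mulr0 (c - c0)); apply: cvgM; first exact: cvg_cst.
    exact: cvg_harmonic.
  have := cvg_comp _ _ cvv cv.
  move=> /cvgr_gt /(_ _ tx) [N _ HN].
  exists N => // k /= Nk; split=> //.
  exact: HN.
have : (\int[mu]_(x in F n) w x @[n --> \oo] -->
        \int[mu]_(x in \bigcup_n F n) w x)%E.
  apply: ge0_nondecreasing_set_cvg_integral => //.
  - by move=> n; exact: ms.
  - by move=> n; exact: pos.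
move=> /cvg_lim <-//; apply: lime_le.
  apply: ereal_nondecreasing_is_cvgn.
  apply: ge0_nondecreasing_set_nondecreasing_integral => //.
  - by move=> n; exact: ms.
  - by move=> n; exact: pos.
apply: nearW => n.
apply: le_trans (HB (v n) (vc n)); apply: ge0_subset_integral => //.
- exact: mF.
- exact: measurable_superlevel.
- by apply: ms; [exact: measurable_superlevel|exact: superlevel_sub].
- by apply: pos; exact: superlevel_sub.
- by move=> x; apply => /=.
Qed.

End superlevel.

Section superlevel_mono.
Context {R : realType}.
Variables al be C s t : R.
Hypotheses (al0 : 0 < al) (be0 : 0 < be) (ab : al + be = 1).
Hypotheses (C0 : 0 < C) (s0 : 0 < s).
Variable H : R -> R.
Hypotheses (mH : measurable_fun `]0, s[ H).
Hypotheses (H0 : forall x, 0 < x < s -> 0 <= H x).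
Hypotheses (uniH : forall x y, 0 < y -> x < s -> s - x <= y <= x -> H x <= H y).
Local Notation L := (split_weight al be C s).
Local Notation m := (Num.min al be).
Local Notation mu := (@lebesgue_measure R).
Local Notation S := (superlevel al be C s t).
Let kap (x : R) : R := (x * (s - x)) `^ (- m).
Let w (x : R) : R := kap x * H x.

Let kap_gt0 x : 0 < x < s -> 0 < kap x.
Proof. by move=> /andP[x0 xs]; rewrite powR_gt0// mulr_gt0// subr_gt0. Qed.

Let kap_near x e : 0 < x < s -> 0 < e ->
  exists2 r, 0 < r & forall y, x - r < y < x + r -> `|kap x - kap y| < e.
Proof.
move=> /andP[x0 xs] e0.
have c : kap y @[y --> x] --> kap x.
  apply: (@continuous_comp R R R (fun y => y * (s - y)) (fun y => y `^ (- m)) x).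
    apply: cvgM; first exact: cvg_id.
    by apply: cvgB; [exact: cvg_cst|exact: cvg_id].
  by apply: continuous_powR; rewrite mulr_gt0// subr_gt0.
have /cvgrPdist_lt /(_ _ e0) /nbhs_ballP [r /= r0 Hr] := c.
exists r => // y ry; apply: Hr; rewrite /ball/= ltr_norml; lra.
Qed.

Let w_ge0 x : 0 < x < s -> 0 <= w x.
Proof. by move=> xs; rewrite mulr_ge0 ?H0// ltW// kap_gt0. Qed.

Let mw : measurable_fun `]0, s[ w.
Proof.
apply: measurable_funM => //; apply: measurable_funTS.
apply: (@measurableT_comp _ _ _ _ _ _ _ _ _ (@measurable_powR R (- m))).
by apply: measurable_funM => //; exact: measurable_funB.
Qed.

Local Notation Phi c := (\int[mu]_(x in S c) (w x)%:E)%E.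

(** The value [K = H b] separates the two strips: as [s <= a + b], unimodality gives [H >= K] on the
    strip lost at [a] and [H <= K] on the strip gained at [b]. The weights are frozen at the end
    points up to [e1], which costs at most [e] per unit of [c]. *)
Lemma superlevel_right_step c e : C / 2 <= c < C -> 0 < e ->
  c `^ be * s `^ al < t < C `^ be * s `^ al ->
  exists2 d, 0 < d & forall c1, c < c1 < c + d -> c1 < C ->
    (Phi c1 <= Phi c + (e * (c1 - c))%:E)%E.
Proof.
move=> cC e0 ct.
have [a [b [sa [sb [[a0 ltab bs sab] Hin [sa0 sb0 Hk] Hout]]]]] :=
  split_weight_level_set al0 be0 ab C0 s0 cC ct.
have a_in : 0 < a < s by rewrite a0; lra.
have b_in : 0 < b < s by rewrite bs andbT; lra.
pose K := H b.
have K0 : 0 <= K by apply: H0.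
(* The first bound keeps [kap a - e1] nonnegative; the second keeps the error [e1 * (K * (sa + sb))]
   below [e], its [+ 1] covering [K = 0]. *)
pose e1 := Num.min (kap a) (e / (K * (sa + sb) + 1)).
have D0 : 0 < K * (sa + sb) + 1.
  by rewrite ltr_wpDl// mulr_ge0// ltW// addr_gt0.
have e10 : 0 < e1 by rewrite lt_min kap_gt0// divr_gt0.
have e1k : e1 <= kap a by rewrite ge_min lexx.
have e1e : e1 * (K * (sa + sb)) <= e.
  have : e1 <= e / (K * (sa + sb) + 1) by rewrite ge_min lexx orbT.
  rewrite ler_pdivlMr// mulrDr mulr1; lra.
have [ra ra0 Hra] := kap_near a_in e10.
have [rb rb0 Hrb] := kap_near b_in e10.
(* The moving ends must stay where [kap] varies by less than [e1], the left one below the old [b]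
   and the right one below [s]. *)
pose d := Num.min (Num.min (ra / sa) ((b - a) / sa))
                  (Num.min (rb / sb) ((s - b) / sb)).
have d0 : 0 < d by rewrite !lt_min !divr_gt0// subr_gt0.
exists d => // c1 /andP[cc1 c1d] c1C.
have : c1 - c < d by lra.
rewrite !lt_min !ltr_pdivlMr//.
set D := c1 - c => /andP[/andP[Dra Dba] /andP[Drb Dsb]].
have D1 : 0 < D by rewrite subr_gt0.
have Dsa0 : 0 < D * sa by rewrite mulr_gt0.
have Dsb0 : 0 < D * sb by rewrite mulr_gt0.
have sub : S c1 `<=` `]a + D * sa, b + D * sb[.
  move=> x [/andP[x0 xs] tL]; rewrite /= in_itv/= !(mulrC D); apply: Hout => //.
    by rewrite (ltW cc1) ltW.
  by rewrite !ltW.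
have ms (A : set R) : measurable A -> A `<=` `]0, s[ ->
    measurable_fun A (EFin \o w).
  by move=> mA As; apply/measurable_EFinP; exact: (measurable_funS _ As mw).
have pos (A : set R) : A `<=` `]0, s[ -> forall x, A x -> (0 <= (w x)%:E)%E.
  by move=> As x /As /=; rewrite in_itv/= lee_fin => /w_ge0.
have subs x y : 0 <= x -> y <= s -> `]x, y[ `<=` (`]0, s[ : set R).
  by move=> x0 ys; apply: subitvP; rewrite subitvE !bnd_simp x0.
have a'0 : 0 <= a + D * sa by rewrite addr_ge0 ?ltW.
have aa' : a <= a + D * sa by rewrite lerDl ltW.
have a'b : a + D * sa < b by rewrite -ltrBrDl.
have bb' : b <= b + D * sb by rewrite lerDl ltW.
have b's : b + D * sb <= s by rewrite -lerBrDl ltW.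
apply: (@le_trans _ _
  (\int[mu]_(x in `](a + D * sa)%R, (b + D * sb)%R[) (w x)%:E)%E).
  apply: ge0_subset_integral => //.
  - exact: measurable_superlevel.
  - by apply: ms => //; exact: subs.
  - by apply: pos; exact: subs.
apply: (@le_trans _ _ (\int[mu]_(x in `]a, b[) (w x)%:E + (e * D)%:E)%E).
  apply: (@integral_itv_shift_le R w s a b (a + D * sa) (b + D * sb)
    ((kap a - e1) * K) ((kap b + e1) * K) (e * D) mw w_ge0 a0 aa' a'b bb' b's).
  - by rewrite mulr_ge0 ?subr_ge0.
  - by rewrite mulr_ge0// addr_ge0 ?ltW// kap_gt0.
  - move=> x /andP[ax xa]; apply: ler_pM => //; first by rewrite subr_ge0.
      have /Hra : a - ra < x < a + ra.
        rewrite (lt_trans _ ax) ?ltrBlDr ?ltrDl//.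
        by rewrite (le_lt_trans xa)// ltrD2l.
      by rewrite ltr_norml => /andP[_]; rewrite ltrBlDl -ltrBlDr => /ltW.
    apply: uniH; rewrite ?bs ?(lt_trans a0 ax)// lerBlDr (le_trans sab)/=.
      exact: ltW (le_lt_trans xa a'b).
    by rewrite lerD2r ltW.
  - move=> x /andP[bx xb].
    have ltxs : x < s by exact: lt_le_trans b's.
    have ltbs : 0 < x < s by rewrite ltxs (lt_le_trans (lt_trans a0 ltab)).
    apply: ler_pM => //; [by rewrite ltW// kap_gt0|exact: H0| |].
      have /Hrb : b - rb < x < b + rb.
        rewrite (lt_le_trans _ bx) ?ltrBlDr ?ltrDl//=.
        by rewrite (lt_trans xb)// ltrD2l.
      by rewrite ltr_norml => /andP[+ _]; rewrite ltrBrDl ltrBlDr => /ltW.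
    apply: uniH => //; first exact: lt_trans ltab.
    by rewrite bx lerBlDr (le_trans sab)// addrC lerD// ltW// (lt_le_trans ltab).
  - rewrite ![_ + D * _ - _]addrAC !subrr !add0r.
    have KD : 0 <= K * D by rewrite mulr_ge0// ltW.
    have := ler_wpM2l KD (Hk : kap b * sb <= kap a * sa).
    have := ler_wpM2r (ltW D1) e1e; lra.
  - by rewrite mulr_ge0// ltW.
rewrite leeD2r//; apply: ge0_subset_integral => //.
- exact: measurable_superlevel.
- by apply: ms; [exact: measurable_superlevel|exact: superlevel_sub].
- by apply: pos; exact: superlevel_sub.
- move=> x; rewrite /= in_itv/= => xab; split; last exact: Hin.
  by case/andP: xab => ax xb; rewrite (lt_trans a0)// (lt_trans xb).
Qed.

End superlevel_mono.

Section superlevel_mono.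
Context {R : realType}.
Variables al be C s t : R.
Hypotheses (al0 : 0 < al) (be0 : 0 < be) (ab : al + be = 1).
Hypotheses (C0 : 0 < C) (s0 : 0 < s).
Variable H : R -> R.
Hypotheses (mH : measurable_fun `]0, s[ H).
Hypotheses (H0 : forall x, 0 < x < s -> 0 <= H x).
Hypotheses (uniH : forall x y, 0 < y -> x < s -> s - x <= y <= x -> H x <= H y).
Local Notation L := (split_weight al be C s).
Local Notation m := (Num.min al be).
Local Notation mu := (@lebesgue_measure R).
Local Notation S := (superlevel al be C s t).
Let kap (x : R) : R := (x * (s - x)) `^ (- m).
Let w (x : R) : R := kap x * H x.

Let kap_gt0 x : 0 < x < s -> 0 < kap x.
Proof. by move=> /andP[x0 xs]; rewrite powR_gt0// mulr_gt0// subr_gt0. Qed.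

Let w_ge0 x : 0 < x < s -> 0 <= w x.
Proof. by move=> xs; rewrite mulr_ge0 ?H0// ltW// kap_gt0. Qed.

Let mw : measurable_fun `]0, s[ w.
Proof.
apply: measurable_funM => //; apply: measurable_funTS.
apply: (@measurableT_comp _ _ _ _ _ _ _ _ _ (@measurable_powR R (- m))).
by apply: measurable_funM => //; exact: measurable_funB.
Qed.

Local Notation Phi c := (\int[mu]_(x in S c) (w x)%:E)%E.

Lemma superlevel_integral_anti (c c' : R) : C / 2 <= c -> c <= c' -> c' < C ->
  (Phi c' <= Phi c)%E.
Proof.
move=> Cc cc' c'C.
have C2 : 0 < C / 2 by rewrite divr_gt0.
have [tC|tC] := leP (C `^ be * s `^ al) t.
  by rewrite !(superlevel_empty _ _ _ _ _ _ tC)//; lra.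
apply/lee_addgt0Pr => e e0.
pose e1 := e / (c' - c + 1).
have cc1 : 0 < c' - c + 1 by lra.
have e10 : 0 < e1 by rewrite divr_gt0.
apply: (@le_trans _ _ (Phi c + (e1 * (c' - c))%:E)%E); last first.
  rewrite leeD2l// lee_fin /e1 mulrAC ler_pdivrMr// ler_pM2l//; lra.
(* A slack linear in [v] adds up exactly over consecutive steps, so that right steps can be chained.
   In [e1], the [+ 1] allows [c' = c]. *)
pose P v := (Phi v <= Phi c + (e1 * (v - c))%:E)%E.
apply: (@real_interval_ind R P c c' cc').
- by rewrite /P subrr mulr0 adde0.
- move=> x /andP[cx xc'] IH.
  rewrite /P; apply: (@superlevel_left_limit _ _ _ _ _ _ (EFin \o w) c x) => //.
  + exact/measurable_EFinP.
  + lra.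
  + lra.
  + move=> v /andP[cv vx]; apply: le_trans (IH v _) _; first by rewrite cv.
    rewrite leeD2l// lee_fin ler_pM2l//; lra.
- move=> x /andP[cx xc'] Px.
  have x0 : 0 < x by lra.
  (* If the value at the right end [s] has reached [t], the sets shrink for all larger parameters,
     and any step length will do. *)
  have [tx|tx] := leP t (x `^ be * s `^ al).
    exists 1 => // y /andP[xy _] yc'.
    apply: (@le_trans _ _ (Phi x)).
      apply: ge0_subset_integral => //.
      * exact: measurable_superlevel.
      * exact: measurable_superlevel.
      * apply/measurable_EFinP; apply: measurable_funS mw => //.
        exact: superlevel_sub.
      * by move=> z /superlevel_sub /=; rewrite in_itv/= lee_fin => /w_ge0.
      * by apply: superlevel_anti => //; lra.
    apply: (le_trans Px); rewrite leeD2l// lee_fin ler_pM2l//; lra.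
  have xC : C / 2 <= x < C by apply/andP; split; lra.
  have txC : x `^ be * s `^ al < t < C `^ be * s `^ al by rewrite tx tC.
  have [d d0 Hd] :=
    superlevel_right_step al0 be0 ab C0 s0 mH H0 uniH xC e10 txC.
  exists d => // y xy yc'; apply: le_trans (Hd y xy _) _; first by lra.
  apply: (@le_trans _ _ (Phi c + (e1 * (x - c))%:E + (e1 * (y - x))%:E)%E).
    by rewrite leeD2r.
  by rewrite -addeA leeD2l// -EFinD lee_fin; lra.
Qed.

End superlevel_mono.

(** * Densities and substitutions *)

Section density.
Local Open Scope ereal_scope.
Context d (T : measurableType d) (R : realType).
Variables (mu : {measure set T -> \bar R}) (g : T -> R).
Hypotheses (mg : measurable_fun [set: T] g) (g0 : forall x, (0 <= g x)%R).

Import HBNNSimple.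

(** Monotone convergence along simple functions reduces the formula to indicators, for which it is
    the hypothesis on [nu]. *)
Lemma ge0_integral_density (nu : {measure set T -> \bar R}) (f : T -> \bar R) :
  (forall A, measurable A -> nu A = \int[mu]_(x in A) (g x)%:E) ->
  measurable_fun [set: T] f -> (forall x, 0 <= f x) ->
  \int[nu]_x f x = \int[mu]_x (f x * (g x)%:E).
Proof.
move=> nuE mf f0; pose h := nnsfun_approx measurableT mf.
have h_ge0 n x : 0 <= (h n x)%:E by rewrite lee_fin.
have h_nd x : {homo (fun n => (h n x)%:E) : n k / (n <= k)%N >-> n <= k}.
  by move=> a b ab; rewrite lee_fin; exact/lefP/nd_nnsfun_approx.
have mh n : measurable_fun [set: T] (fun x => (h n x)%:E).
  exact/measurable_EFinP.
have h_cvg x : (fun n => (h n x)%:E) n @[n --> \oo] --> f x.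
  exact: cvg_nnsfun_approx.
have -> : \int[nu]_x f x = limn (fun n => \int[nu]_x (h n x)%:E).
  rewrite -monotone_convergence//.
  by apply: eq_integral => x _; apply/esym/cvg_lim.
have -> : \int[mu]_x (f x * (g x)%:E) =
    limn (fun n => \int[mu]_x ((h n x)%:E * (g x)%:E)).
  rewrite -monotone_convergence//; last 3 first.
  - by move=> n; apply: emeasurable_funM => //; exact/measurable_EFinP.
  - by move=> n x _; rewrite mule_ge0// lee_fin.
  - by move=> x _ a b ab; rewrite lee_wpmul2r ?lee_fin//; exact: h_nd.
  apply: eq_integral => x _; apply/esym/cvg_lim => //.
  by apply: cvgeZr.
congr (limn _); apply/funext => n.
rewrite integralT_nnsfun sintegralE.
under [RHS]eq_integral => x _.
  rewrite fimfunE -fsumEFin// ge0_mule_fsuml; last first.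
    by move=> y; exact: nnfun_muleindic_ge0.
  over.
rewrite ge0_integral_fsum//; last 2 first.
- move=> y; apply: emeasurable_funM; last exact/measurable_EFinP.
  by apply/measurable_EFinP; exact: measurable_funM.
- by move=> y x _; rewrite mule_ge0 ?lee_fin//; exact: nnfun_muleindic_ge0.
apply: eq_fsbigr => r rhn.
rewrite nuE//.
under [RHS]eq_integral do rewrite EFinM -muleA.
have r0 : (0 <= r)%R by move: rhn; rewrite inE => -[x _ <-].
rewrite ge0_integralZl_EFin//; last 2 first.
- by move=> x _; rewrite mule_ge0// lee_fin.
- by apply: emeasurable_funM; apply/measurable_EFinP.
congr (_ * _); rewrite integral_mkcond; apply: eq_integral => x _.
by rewrite patchE indicE; case: ifPn => _; rewrite ?mul1e ?mul0e.
Qed.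

End density.

Section density_measure.
Local Open Scope ereal_scope.
Context d (T : measurableType d) (R : realType).
Variables (mu : {measure set T -> \bar R}) (g : T -> R).
Hypotheses (mg : measurable_fun [set: T] g) (g0 : forall x, (0 <= g x)%R).

(** The proofs are arguments so that the measure structure can be attached to the term itself. *)
Definition density_measure (_ : measurable_fun [set: T] g)
  (_ : forall x, (0 <= g x)%R) (A : set T) := \int[mu]_(x in A) (g x)%:E.

Local Notation D := (density_measure mg g0).

Let density0 : D set0 = 0%E.
Proof. by rewrite /D integral_set0. Qed.

Let density_ge0 A : (0 <= D A)%E.
Proof. by apply: integral_ge0 => x _; rewrite lee_fin. Qed.

Let density_sigma_additive : semi_sigma_additive D.
Proof.
move=> /= A mA tA mUA; rewrite /D/= ge0_integral_bigcup//=.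
- by apply: is_cvg_ereal_nneg_natsum_cond => n _ _; exact: density_ge0.
- by apply/measurable_EFinP; exact: measurable_funTS.
- by move=> x _; rewrite lee_fin.
Qed.

HB.instance Definition _ := isMeasure.Build _ _ _
  D density0 density_ge0 density_sigma_additive.

End density_measure.

(** * Substitution by a power, translation, and the law of a power *)

Section power_substitution.
Context {R : realType}.
Local Notation mu := (@lebesgue_measure R).
Variable p : R.
Hypothesis p1 : 1 < p.

(** The truncation kills the negative half-line, where [y^p] is constantly 1 and would put an
    infinite atom into the push-forward. *)
Let jac (y : R) : R := p * Num.max y 0 `^ (p - 1).

Let pos1 (x : R) : R := \1_(`]0%R, +oo[ : set R) x.

Let p0 : 0 < p. Proof. exact: lt_trans p1. Qed.

Let pm1 : 0 < p - 1. Proof. by rewrite subr_gt0. Qed.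

Let c_jac : continuous jac.
Proof. by move=> x; apply: cvgM; [exact: cvg_cst|exact: continuous_powR_max0]. Qed.

Let m_jac : measurable_fun [set: R] jac.
Proof. exact: continuous_measurable_fun. Qed.

Let jac_ge0 y : 0 <= jac y.
Proof. by rewrite mulr_ge0 ?powR_ge0 ?(ltW p0). Qed.

Let jac0 y : y <= 0 -> jac y = 0.
Proof. by move=> y0; rewrite /jac max_r// powR0 ?mulr0 ?gt_eqF. Qed.

Let m_pos1 : measurable_fun [set: R] pos1. Proof. exact: measurable_indic. Qed.

Let pos1_ge0 y : 0 <= pos1 y. Proof. by []. Qed.

Let int_pos (A : set R) (f : R -> R) : (forall x, x <= 0 -> f x = 0) ->
  (\int[mu]_(x in A) (f x)%:E = \int[mu]_(x in A `&` `]0%R, +oo[) (f x)%:E)%E.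
Proof.
move=> f0; rewrite integral_mkcond [RHS]integral_mkcond.
apply: eq_integral => x _; rewrite !patchE in_setI.
have [//|x0] := boolP (x \in `]0%R, +oo[%classic); first by rewrite andbT.
rewrite andbF; case: ifP => // _; rewrite f0// leNgt; apply: contra x0.
by move=> x0; rewrite inE/= in_itv/= x0.
Qed.

Let int_pos1 (b : R) :
  (\int[mu]_(x in `]-oo, b[) (pos1 x)%:E = (Num.max 0 b)%:E)%E.
Proof.
rewrite integral_indic//= -set_itvI/= lebesgue_measure_itv/=.
by rewrite lte_fin oppr0 adde0; have [b0|b0] := ltP 0 b.
Qed.

Let int_jac (b : R) : 0 < b ->
  (\int[mu]_(x in `[0%R, b]) (jac x)%:E = (b `^ p)%:E)%E.
Proof.
move=> b0; rewrite (@continuous_FTC2 R jac (fun y : R => y `^ p))//.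
- by rewrite powR0 ?gt_eqF// sube0.
- exact: continuous_subspaceT.
- split.
  + by move=> x /[!in_itv]/= /andP[x0 _]; apply: derivable_powR; rewrite in_itv/= x0.
  + by rewrite powR0 ?gt_eqF//; exact: powR_cvg0.
  + by apply: cvg_at_left_filter; exact: continuous_powR.
- move=> x /[!in_itv]/= /andP[x0 _]; rewrite powR_derive1 ?in_itv/= ?x0//.
  by rewrite /jac max_l ?ltW.
Qed.

(** Pushing the measure of density [jac] forward by [y^p] gives Lebesgue measure on the positive
    half-line. The two are compared on the rays []-oo, b[], by the fundamental theorem of
    calculus. *)
Lemma integral_power_substitution (h : R -> \bar R) :
  measurable_fun [set: R] h -> (forall x, 0 <= h x)%E ->
  (\int[mu]_x (h x * (pos1 x)%:E) =
   \int[mu]_y (h (y `^ p)%R * (jac y)%:E))%E.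
Proof.
move=> mh h0.
have mpow : measurable_fun [set: R] (fun y : R => y `^ p) by exact: measurable_powR.
pose D1 : {measure set (measurableTypeR R) -> \bar R} :=
  density_measure mu m_pos1 pos1_ge0.
pose D2 : {measure set (measurableTypeR R) -> \bar R} :=
  density_measure mu m_jac jac_ge0.
transitivity (\int[D1]_x h x)%E.
  by apply/esym; exact: (@ge0_integral_density _ (measurableTypeR R) R mu pos1).
transitivity (\int[D2]_x h (x `^ p)%R)%E; last first.
  apply: (@ge0_integral_density _ (measurableTypeR R) R mu jac m_jac jac_ge0 D2
    (fun y : R => h (y `^ p))) => //.
  exact: measurableT_comp.
rewrite -[RHS](@ge0_integral_pushforward _ _ (measurableTypeR R) (measurableTypeR R) R
  (fun y : R => y `^ p) mpow D2 setT h)//.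
apply: eq_measure_integral => A mA _.
apply: (@measure_unique _ R (measurableTypeR R) (@RGenInftyO.G R)
  (fun n => `]-oo, n%:R[%classic)) => //.
- exact: RGenInftyO.measurableE.
- move=> _ _ [x ->] [y ->]; exists (Num.min x y).
  by apply/seteqP; split => z; rewrite /= !in_itv/= lt_min => /andP.
- by move=> n; exists n%:R.
- rewrite -subTset => x _; exists (Num.bound `|x|) => //=.
  by rewrite in_itv/=; apply: le_lt_trans (ler_norm _) _; exact: archi_boundP.
- move=> _ [b ->].
  have -> : D1 `]-oo, b[%classic = (Num.max 0 b)%:E by exact: int_pos1.
  rewrite /= /pushforward.
  have -> : D2 ((fun y : R => y `^ p) @^-1` `]-oo, b[) =
      (\int[mu]_(x in ((fun y : R => (y `^ p)%R) @^-1` `]-oo, b[) `&` `]0%R, +oo[)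
        (jac x)%:E)%E.
    by apply: int_pos => x; exact: jac0.
  have [b0|b0] := leP b 0.
    rewrite [X in (\int[mu]_(x in X) _)%E](_ : _ = set0) ?integral_set0//.
    rewrite -subset0 => y [/=]; rewrite !in_itv/= andbT => + y0.
    by rewrite ltNge (le_trans b0)// powR_ge0.
  have bE : b = (b `^ p^-1) `^ p.
    by rewrite -powRrM mulVf ?gt_eqF// powRr1// ltW.
  rewrite [X in (\int[mu]_(x in X) _)%E](_ : _ = `]0, b `^ p^-1[%classic).
    rewrite -(@integral_itv_bndoo _ _ _ _ true false).
      by rewrite int_jac ?powR_gt0// -bE.
    by apply/measurable_EFinP; apply: measurable_funTS; exact: m_jac.
  apply/seteqP; split => y /=; rewrite !in_itv/= andbT.
    move=> [yb y0]; rewrite y0/= ltNge; apply/negP => by'.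
    move: yb; rewrite ltNge {1}bE ge0_ler_powR// ?nnegrE ?powR_ge0 ?(ltW y0)//.
    exact: ltW.
  by move=> /andP[y0 yb]; split => //; rewrite bE powR_lt// ltW.
- move=> n.
  have -> : D1 `]-oo, n%:R[%classic = (Num.max 0 n%:R)%:E by exact: int_pos1.
  exact: ltry.
Qed.

End power_substitution.

Section translation.
Context {R : realType}.
Local Notation mu := (@lebesgue_measure R).

Let mtr (c : R) : measurable_fun [set: measurableTypeR R]
  ((fun x : R => x - c) : measurableTypeR R -> measurableTypeR R).
Proof. exact: measurable_funB. Qed.

Lemma lebesgue_measure_translation (c : R) (A : set R) : measurable A ->
  pushforward mu ((fun x : R => x - c) : _ -> measurableTypeR R) A = mu A.
Proof.
move=> mA; apply/esym.
apply: (@lebesgue_measure_unique R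
  (measure_function_pushforward__canonical__measure_function_Measure mu (mtr c))) => //.
move=> _ [[a b] _ <-] /=; rewrite /pushforward.
have -> : (fun x : R => x - c) @^-1` `]a, b]%classic = `](a + c), (b + c)]%classic.
  by apply/seteqP; split => x /=; rewrite !in_itv/= ltrBrDr lerBlDr.
rewrite !lebesgue_measure_itv/= !lte_fin ltrD2r; case: ifP => // _.
by rewrite -!EFinB; congr (_%:E); lra.
Qed.

Lemma ge0_integral_translation (c : R) (h : R -> \bar R) :
  measurable_fun [set: R] h -> (forall x, (0 <= h x)%E) ->
  (\int[mu]_x h (x - c)%R = \int[mu]_x h x)%E.
Proof.
move=> mh h0.
rewrite -[LHS](@ge0_integral_pushforward _ _ (measurableTypeR R)
  (measurableTypeR R) R (fun x : R => x - c) (mtr c) mu setT h)//.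
by apply: eq_measure_integral => A mA _; exact: lebesgue_measure_translation.
Qed.

End translation.

Section density_power.
Context {R : realType}.
Local Notation mu := (@lebesgue_measure R).
Variables (p : R) (f : R -> R) (P : probability R R).
Hypotheses (p1 : 1 < p) (mf : measurable_fun (`]0, +oo[ : set R) f).
Hypotheses (f0 : forall y, 0 < y -> 0 <= f y).
Hypothesis (Pf : forall A : set R, measurable A ->
  P A = (\int[mu]_(y in A `&` `]0%R, +oo[) (f y)%:E)%E).

(** The density of [Y^p] when [Y] has density [f]. *)
Definition power_density (x : R) : R :=
  if 0 < x then f (x `^ p^-1) * (x `^ (p^-1 - 1) / p) else 0.

Let f1 (y : R) : R := if 0 < y then f y else 0.

Let mf1 : measurable_fun [set: R] f1.
Proof.
have -> : f1 = f \_ `]0, +oo[.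
  apply/funext => y; rewrite /f1 patchE.
  case: ifPn => y0; first by rewrite mem_set//= in_itv/= y0.
  by rewrite memNset//= in_itv/= (negbTE y0).
by apply/(measurable_restrictT f (measurable_itv _)).
Qed.

Let f1_ge0 y : 0 <= f1 y.
Proof. by rewrite /f1; case: ifPn => // /f0. Qed.

Lemma power_density_ge0 x : 0 <= power_density x.
Proof.
rewrite /power_density; case: ifPn => // x0.
rewrite mulr_ge0// ?f0 ?powR_gt0// divr_ge0 ?powR_ge0//.
by rewrite ltW// (lt_trans ltr01).
Qed.

Let g (x : R) : R := f1 (x `^ p^-1) * (x `^ (p^-1 - 1) / p).

Let g_ge0 x : 0 <= g x.
Proof.
by rewrite mulr_ge0// divr_ge0 ?powR_ge0// ltW// (lt_trans ltr01).
Qed.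

Let mg : measurable_fun [set: R] g.
Proof.
apply: measurable_funM; last first.
  by apply: measurable_funM => //; exact: measurable_powR.
exact: (@measurableT_comp _ _ _ _ _ _ _ _ _ mf1 (@measurable_powR R p^-1)).
Qed.

Let power_densityE x : power_density x = g x * \1_(`]0, +oo[ : set R) x.
Proof.
rewrite /power_density /g indicE; case: ifPn => x0.
  by rewrite /f1 powR_gt0// mem_set ?mulr1//= in_itv/= x0.
by rewrite memNset ?mulr0//= in_itv/= (negbTE x0).
Qed.

Lemma measurable_power_density : measurable_fun [set: R] power_density.
Proof.
rewrite (_ : power_density = fun x => g x * \1_(`]0, +oo[ : set R) x).
  by apply: measurable_funM => //; exact: measurable_indic.
by apply/funext => x; exact: power_densityE.
Qed.

Lemma integral_law_power_density (h : R -> \bar R) :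
  measurable_fun [set: R] h -> (forall x, (0 <= h x)%E) ->
  (\int[P]_y h y = \int[mu]_x (h (x `^ p^-1)%R * (power_density x)%:E))%E.
Proof.
move=> mh h0; have p0 : 0 < p by exact: lt_trans p1.
have mpow r : measurable_fun [set: R] (fun y : R => y `^ r) by exact: measurable_powR.
transitivity (\int[mu]_y (h y * (f1 y)%:E))%E.
  (* [P] and the Lebesgue measure live on different copies of [R]. *)
  have mid : measurable_fun [set: R] (id : R -> measurableTypeR R).
    exact: measurable_id.
  pose P' : {measure set (measurableTypeR R) -> \bar R} :=
    measure_function_pushforward__canonical__measure_function_Measure P mid.
  transitivity (\int[P']_y h y)%E.
    by rewrite (@ge0_integral_pushforward _ _ R (measurableTypeR R) R id mid P setT h).
  apply: (@ge0_integral_density _ (measurableTypeR R) R mu f1) => //.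
  move=> A mA; rewrite [LHS]Pf// preimage_id [LHS]integral_mkcond [RHS]integral_mkcond.
  apply: eq_integral => y _; rewrite !patchE in_setI /f1.
  have [yA|yA] //= := boolP (y \in A).
  case: ifPn => [/set_mem/=|y0]; first by rewrite in_itv/= andbT => ->.
  case: ifPn => // y0'; move: y0; rewrite mem_set//= in_itv/=.
  by rewrite y0'.
have := @integral_power_substitution R p p1
  (fun x => h (x `^ p^-1)%R * (g x)%:E)%E.
move=> H.
have -> : (\int[mu]_x (h (x `^ p^-1)%R * (power_density x)%:E) =
    \int[mu]_x (h (x `^ p^-1)%R * (g x)%:E * (\1_(`]0%R, +oo[ : set R) x)%:E))%E.
  by apply: eq_integral => x _; rewrite power_densityE EFinM muleA.
rewrite {}H; last 2 first.
- apply: emeasurable_funM; last exact/measurable_EFinP.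
  exact: (@measurableT_comp _ _ _ _ _ _ _ _ _ mh (mpow p^-1)).
- by move=> x; rewrite mule_ge0// lee_fin.
apply: eq_integral => y _; have [y0|y0] := leP y 0.
  rewrite /f1 ltNge y0/= mule0 powR0 ?mulr0 ?mule0//.
  by rewrite gt_eqF// subr_gt0.
have yK : (y `^ p) `^ p^-1 = y.
  by rewrite -powRrM divff ?gt_eqF// powRr1// ltW.
rewrite yK -muleA -EFinM; congr (_ * _%:E)%E.
rewrite /g yK -mulrA.
have yE : (y `^ p) `^ (p^-1 - 1) * y `^ (p - 1) = 1.
  rewrite -powRrM mulrBr divff ?gt_eqF// mulr1 -powRD.
    by rewrite addrA subrK subrr powRr0.
  by apply/implyP => _; rewrite gt_eqF.
rewrite [X in _ * X](_ : _ = (y `^ p) `^ (p^-1 - 1) * y `^ (p - 1)).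
  by rewrite yE mulr1.
by field; rewrite gt_eqF.
Qed.

End density_power.

(** * Two summands *)

Section log_concave.
Context {R : realType}.
Variables (r al : R) (f : R -> R).
Hypothesis f0 : forall y, 0 < y -> 0 <= f y.
Let g (x : R) : \bar R := ((r * ln x)%:E + lne (f (x `^ al))%:E)%E.
Hypothesis conc : ext_concave (`]0, +oo[ : set R) g.

Let F (x : R) : R := x `^ r * f (x `^ al).

Let F_ge0 x : 0 < x -> 0 <= F x.
Proof. by move=> x0; rewrite mulr_ge0 ?powR_ge0// f0// powR_gt0. Qed.

Let F_exp x : 0 < x -> 0 < F x -> (-oo < g x)%E /\ F x = expR (fine (g x)).
Proof.
move=> x0 Fx; have fx : 0 < f (x `^ al).
  by move: Fx; rewrite /F pmulr_rgt0// powR_gt0.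
rewrite /g lne_EFin// -EFinD ltNyr; split => //=.
by rewrite expRD lnK ?posrE// /F /powR gt_eqF.
Qed.

Let F_gt0 x : 0 < x -> (-oo < g x)%E -> 0 < F x.
Proof.
move=> x0; rewrite /F pmulr_rgt0 ?powR_gt0// /g; apply: contraTT => fx.
by rewrite le0_lneNy ?addeNy ?ltxx// lee_fin leNgt.
Qed.

(** The points [y] and [s - y] are convex combinations of [x] and [s - x] with the weights [l] and
    [1 - l] exchanged, so the sum of the two concavity inequalities is free of [l]. If [F] vanishes
    at [x] or [s - x], the left side is 0. *)
Lemma log_concave_pair (s x y : R) : 0 < y -> x < s -> s - x <= y <= x ->
  F x * F (s - x) <= F y * F (s - y).
Proof.
move=> y0 xs /andP[sxy yx].
have x0 : 0 < x by lra.
have sx0 : 0 < s - x by lra.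
have sy0 : 0 < s - y by lra.
have [Fx|Fx] := leP (F x) 0.
  by rewrite (@le_anti _ _ (F x) 0) ?Fx ?F_ge0// mul0r mulr_ge0 ?F_ge0.
have [Fsx|Fsx] := leP (F (s - x)) 0.
  rewrite (@le_anti _ _ (F (s - x)) 0) ?Fsx ?F_ge0//.
  by rewrite mulr0 mulr_ge0 ?F_ge0.
move: yx; rewrite le_eqVlt => /predU1P[->//|yx].
have d0 : 0 < x - (s - x) by lra.
pose l := (y - (s - x)) / (x - (s - x)).
have l0 : 0 <= l by apply: divr_ge0; lra.
have l1 : l <= 1 by rewrite /l ler_pdivrMr//; lra.
have yE : l * x + (1 - l) * (s - x) = y by rewrite /l; field; rewrite gt_eqF.
have syE : l * (s - x) + (1 - l) * x = s - y by lra.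
have [gx FxE] := F_exp x0 Fx; have [gsx FsxE] := F_exp sx0 Fsx.
case: conc => convS convg.
set S := (X in convex_set X) in convS.
have Sx : x \in S by rewrite inE; split => //=; rewrite in_itv/= x0.
have Ssx : (s - x) \in S by rewrite inE; split => //=; rewrite in_itv/= sx0.
have := convS x (s - x) (Itv01 l0 l1) Sx Ssx.
have := convS (s - x) x (Itv01 l0 l1) Ssx Sx.
have := convg (Itv01 l0 l1) x (s - x) Sx Ssx.
have := convg (Itv01 l0 l1) (s - x) x Ssx Sx.
move=> gsyle gyle Ssy Sy.
have {}gsyle : - fine (g (l * (s - x) + (1 - l) * x)) <=
    l * - fine (g (s - x)) + (1 - l) * - fine (g x) := gsyle.
have {}gyle : - fine (g (l * x + (1 - l) * (s - x))) <=
    l * - fine (g x) + (1 - l) * - fine (g (s - x)) := gyle.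
have {}Ssy : (l * (s - x) + (1 - l) * x) \in S := Ssy.
have {}Sy : (l * x + (1 - l) * (s - x)) \in S := Sy.
rewrite syE in gsyle Ssy; rewrite yE in gyle Sy.
have [_ /= gsy] := set_mem Ssy; have [_ /= gy] := set_mem Sy.
have [_ ->] := F_exp y0 (F_gt0 y0 gy).
have [_ ->] := F_exp sy0 (F_gt0 sy0 gsy).
by rewrite FxE FsxE -!expRD ler_expR; lra.
Qed.

End log_concave.

Section pair_integral.
Context {R : realType}.
Local Notation mu := (@lebesgue_measure R).
Variables (p q : R) (f : R -> R).
Hypotheses (p1 : 1 < p) (pq : p^-1 + q^-1 = 1).
Hypothesis mf : measurable_fun (`]0, +oo[ : set R) f.
Hypothesis f0 : forall y, 0 < y -> 0 <= f y.
Hypothesis conc : ext_concave (`]0, +oo[ : set R)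
  (fun x => (Num.min 0 (2 / p - 1) * ln x)%:E + lne (f (x `^ p^-1))%:E)%E.
Variables (C t : R).

Local Notation al := p^-1.
Local Notation be := q^-1.
Local Notation m := (Num.min al be).
Local Notation rho := (power_density p f).

Let p0 : 0 < p. Proof. exact: lt_trans p1. Qed.
Let al0 : 0 < al. Proof. by rewrite invr_gt0. Qed.
Let be0 : 0 < be.
Proof. by rewrite -(ltrD2l al) addr0 pq invf_lt1. Qed.

Let rho0 x : x <= 0 -> rho x = 0.
Proof. by rewrite /power_density ltNge => ->. Qed.

Let mrho : measurable_fun [set: R] rho.
Proof. exact: measurable_power_density. Qed.

Let rho_ge0 x : 0 <= rho x.
Proof. exact: power_density_ge0. Qed.

Let F (x : R) : R := x `^ (Num.min 0 (2 / p - 1)) * f (x `^ al).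

(** The exponent in the concavity hypothesis is [m + (al - 1)], where [al - 1] is the Jacobian
    exponent in [rho]. *)
Let rhoE x : 0 < x -> x `^ m * rho x = al * F x.
Proof.
move=> x0; rewrite /power_density x0 /F.
have -> : Num.min 0 (2 / p - 1) = m + (al - 1).
  have -> : 2 / p - 1 = al + (al - 1) by ring.
  have -> : 0 = be + (al - 1) by rewrite -pq; ring.
  by rewrite -addr_minl minC.
rewrite powRD; last by apply/implyP => _; rewrite gt_eqF.
by ring.
Qed.

Let kernel (c : R) (x y : R) : R :=
  (t < c `^ be * x `^ al + (C - c) `^ be * y `^ al)%R%:R * (rho x * rho y).

Let kernel_ge0 c x y : 0 <= kernel c x y.
Proof. by rewrite !mulr_ge0. Qed.

Let mkernel d (T : measurableType d) (u v : T -> R) c :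
  measurable_fun [set: T] u -> measurable_fun [set: T] v ->
  measurable_fun [set: T] (fun z => kernel c (u z) (v z)).
Proof.
move=> mu' mv'.
have mpow r (w : T -> R) : measurable_fun [set: T] w ->
    measurable_fun [set: T] (fun z => w z `^ r).
  move=> mw; exact: (@measurableT_comp _ _ _ _ _ _ _ _ _ (@measurable_powR R r) mw).
apply: measurable_funM; last first.
  by apply: measurable_funM; [exact: (@measurableT_comp _ _ _ _ _ _ _ _ _ mrho mu')
                             |exact: (@measurableT_comp _ _ _ _ _ _ _ _ _ mrho mv')].
rewrite (_ : (fun _ => _) = (fun z =>
    if t < c `^ be * u z `^ al + (C - c) `^ be * v z `^ al then 1 else 0)).
  apply: measurable_fun_ifT => //; apply: measurable_fun_ltr => //.
  by apply: measurable_funD; apply: measurable_funM => //; exact: mpow.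
by apply/funext => z; case: ifP.
Qed.

Definition pair_tail (c : R) : \bar R := (\int[mu]_x \int[mu]_y
  ((t < c `^ be * x `^ al + (C - c) `^ be * y `^ al)%R%:R * (rho x * rho y))%:E)%E.

Let slice c s := (\int[mu]_x (kernel c x (s - x))%:E)%E.

Let pair_tail_slice c : pair_tail c = (\int[mu]_s slice c s)%E.
Proof.
transitivity (\int[mu]_x \int[mu]_s (kernel c x (s - x))%:E)%E.
  apply: eq_integral => x _.
  rewrite -(@ge0_integral_translation R x (fun y => (kernel c x y)%:E))//.
    by apply/measurable_EFinP; apply: mkernel.
  by move=> y; rewrite lee_fin.
apply: (@fubini_tonelli _ _ (measurableTypeR R) (measurableTypeR R) R mu mu
  (fun z => (kernel c z.1 (z.2 - z.1))%:E)).
- apply/measurable_EFinP.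
  apply: (@mkernel _ (measurableTypeR R * measurableTypeR R)%type).
    exact: measurable_fst.
  by apply: measurable_funB; [exact: measurable_snd|exact: measurable_fst].
- by move=> z; rewrite lee_fin.
Qed.

Let mslice c : measurable_fun [set: R] (slice c).
Proof.
apply: (@measurable_fun_fubini_tonelli_G _ _ (measurableTypeR R) (measurableTypeR R) R mu
  (fun z => (kernel c z.1 (z.2 - z.1))%:E)).
- apply/measurable_EFinP.
  apply: (@mkernel _ (measurableTypeR R * measurableTypeR R)%type).
    exact: measurable_fst.
  by apply: measurable_funB; [exact: measurable_snd|exact: measurable_fst].
- by move=> z; rewrite lee_fin.
Qed.

Let slice_le c c' s : C / 2 <= c -> c <= c' -> c' < C ->
  (slice c' s <= slice c s)%E.
Proof.
move=> Cc cc' c'C.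
have [s0|s0] := leP s 0.
  have z c1 : slice c1 s = 0%E.
    rewrite /slice (eq_integral (cst 0%E)) ?integral0// => x _.
    rewrite /kernel; have [x0|x0] := leP x 0; first by rewrite (rho0 x0) mul0r mulr0.
    by rewrite (@rho0 (s - x)) ?mulr0//; lra.
  by rewrite !z.
have C0 : 0 < C by lra.
(* Up to [al * al] this is [F x * F (s - x)], so [log_concave_pair] provides the unimodality. *)
pose H (x : R) : R := (x * (s - x)) `^ m * (rho x * rho (s - x)).
have HF x : 0 < x < s -> H x = al * al * (F x * F (s - x)).
  move=> /andP[x0 xs]; rewrite /H powRM ?subr_ge0 ?ltW//.
  by rewrite mulrACA !rhoE ?subr_gt0//; ring.
have mH : measurable_fun [set: R] H.
  have mB : measurable_fun [set: R] (fun x => s - x) by exact: measurable_funB.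
  apply: measurable_funM; last first.
    by apply: measurable_funM => //; exact: (@measurableT_comp _ _ _ _ _ _ _ _ _ mrho mB).
  apply: (@measurableT_comp _ _ _ _ _ _ _ _ _ (@measurable_powR R m)).
  exact: measurable_funM.
have sliceE c1 : slice c1 s = (\int[mu]_(x in superlevel al be C s t c1)
    ((x * (s - x)) `^ (- m) * H x)%:E)%E.
  rewrite [RHS]integral_mkcond; apply: eq_integral => x _; rewrite patchE.
  have [xS|xS] := boolP (x \in superlevel al be C s t c1).
    have [/andP[x0 xs] tx] := set_mem xS.
    rewrite /kernel; move: tx; rewrite /split_weight => ->; rewrite mul1r /H mulrA.
    by rewrite powRN mulVf ?mul1r// gt_eqF// powR_gt0// mulr_gt0// subr_gt0.
  rewrite /kernel; have [x0|x0] := leP x 0; first by rewrite (rho0 x0) mul0r mulr0.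
  have [xs|xs] := leP s x; first by rewrite (@rho0 (s - x)) ?mulr0//; lra.
  rewrite ltNge; case: leP => //=; rewrite ?mul0r// => tx.
  by move: xS; rewrite mem_set//; split => //; rewrite x0.
rewrite !sliceE; apply: superlevel_integral_anti => //.
- exact: measurable_funTS.
- by move=> x xs; rewrite !mulr_ge0 ?powR_ge0.
- move=> x y y0 xs /[dup] sxy /andP[sxy1 yx].
  rewrite !HF; [|by rewrite y0; lra|by rewrite xs; lra].
  rewrite ler_pM2l ?mulr_gt0//.
  exact: (log_concave_pair f0 conc).
Qed.

Lemma pair_tail_anti c c' : C / 2 <= c -> c <= c' -> c' < C ->
  (pair_tail c' <= pair_tail c)%E.
Proof.
move=> Cc cc' c'C; rewrite !pair_tail_slice.
apply: (@ge0_le_integral _ (measurableTypeR R) R mu setT measurableT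
  (slice c') (slice c) _ (mslice c') (mslice c)).
- by move=> s _; apply: integral_ge0 => x _; rewrite lee_fin.
- by move=> s _; exact: slice_le.
Qed.

End pair_integral.

(** * Laws of weighted sums *)

Section rectangles.
Context d1 d2 (T1 : measurableType d1) (T2 : measurableType d2) (R : realType).
Variables m1 m2 : {measure set (T1 * T2) -> \bar R}.

Lemma finite_measure_rectangle_unique :
  (m1 setT < +oo)%E ->
  (forall A B, measurable A -> measurable B -> m1 (A `*` B) = m2 (A `*` B)) ->
  forall X, measurable X -> m1 X = m2 X.
Proof.
move=> m1oo m12 X mX.
pose G : set (set (T1 * T2)) := [set A `*` B | A in measurable & B in measurable].
apply: (measure_unique G (fun=> setT)) => //.
- by rewrite measurable_prod_measurableType.
- move=> _ _ [A1 mA1 [B1 mB1 <-]] [A2 mA2 [B2 mB2 <-]].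
  by rewrite -setXI; exists (A1 `&` A2); [exact: measurableI|
    exists (B1 `&` B2) => //; exact: measurableI].
- by move=> _; exists setT => //; exists setT => //; rewrite setXTT.
- by rewrite -subTset => x _; exists 0%N.
- by move=> _ [A mA [B mB <-]]; exact: m12.
Qed.

End rectangles.

Definition axpy (R : realType) (c : R) (z : R * R) : R := c * z.1 + z.2.

Lemma measurable_axpy (R : realType) (c : R) :
  measurable_fun [set: R * R] (axpy c).
Proof. by apply: measurable_funD => //; exact: measurable_funM. Qed.

HB.instance Definition _ (R : realType) (c : R) :=
  isMeasurableFun.Build _ _ (R * R)%type R (axpy c) (measurable_axpy c).

(* The law of [\sum_k c_k Y_k] for independent [Y_k] of common law [mu]. *)
Fixpoint weighted_law (R : realType) (mu : probability R R) (cs : seq R) :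
    probability R R :=
  if cs is c :: cs' then
    distribution (mu \x weighted_law mu cs')%E (axpy c)
  else \d_(0 : R).

Section independent_sum.
Context (R : realType) d (T : measurableType d) (P : probability T R).
Context (I : finType) (Y : I -> {RV P >-> R}) (mu : probability R R).
Variable c : I -> R.

Let S (l : seq I) (w : T) : R := \sum_(i <- l) c i * Y i w.

Let mS l : measurable_fun [set: T] (S l).
Proof. by apply: measurable_sum => i; exact: measurable_funM. Qed.

(** The event [E] makes the induction work: a condition on [Y k] is absorbed into it. Restricted to
    [E], the pair formed by [Y k] and the remaining sum then has [P E] times a product law on
    rectangles, hence everywhere. *)
Lemma independent_event_sum (l : seq I) (E : set T) : uniq l -> measurable E ->
  (forall B : I -> set R, (forall i, measurable (B i)) ->
    P (E `&` \bigcap_(i in [set i | i \in l]) (Y i @^-1` B i)) =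
    (P E * \prod_(i <- l) mu (B i))%E) ->
  forall B, measurable B ->
    P (E `&` S l @^-1` B) = (P E * weighted_law mu [seq c i | i <- l] B)%E.
Proof.
elim: l E => [|k l IH] E /=.
  move=> _ mE _ B mB.
  have -> : S [::] @^-1` B = if 0 \in B then setT else set0.
    apply/seteqP; split => w; rewrite /S /= big_nil.
      by move=> B0; rewrite mem_set.
    by case: ifPn => [/set_mem|].
  rewrite diracE; case: (0 \in B); first by rewrite setIT mule1.
  by rewrite setI0 measure0 mule0.
move=> /andP[kl ul] mE indE B mB.
have mYk A : measurable A -> measurable (Y k @^-1` A).
  by move=> mA; rewrite -[_ @^-1` _]setTI; exact: measurable_funP.
have indE' (A : set R) : measurable A ->
    P (E `&` Y k @^-1` A) = (P E * mu A)%E /\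
    forall B', measurable B' ->
      P (E `&` Y k @^-1` A `&` S l @^-1` B') =
      (P E * mu A * weighted_law mu [seq c i | i <- l] B')%E.
  move=> mA.
  have H (B0 : I -> set R) : (forall i, measurable (B0 i)) ->
      P (E `&` Y k @^-1` A `&` \bigcap_(i in [set i | i \in l]) (Y i @^-1` B0 i)) =
      (P E * mu A * \prod_(i <- l) mu (B0 i))%E.
    move=> mB0; pose B1 i := if i == k then A else B0 i.
    have B1k : B1 k = A by rewrite /B1 eqxx.
    have := indE B1; rewrite big_cons B1k muleA.
    have -> : (\prod_(i <- l) mu (B1 i) = \prod_(i <- l) mu (B0 i))%E.
      apply: eq_big_seq => i il; rewrite /B1; case: eqP => // ik.
      by rewrite -ik il in kl.
    move=> <-; last by move=> i; rewrite /B1; case: ifP.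
    rewrite -setIA; congr (P (_ `&` _)); apply/seteqP; split => w /=.
      move=> [wA wB] i /=; rewrite in_cons /B1 => /orP[/eqP ->|il]; rewrite ?eqxx//.
      case: eqP => [ik|_]; first by rewrite -ik il in kl.
      exact: wB.
    move=> wB; split.
      by have := wB k; rewrite /= in_cons eqxx /B1 eqxx; exact.
    move=> i /= il; have := wB i; rewrite /= in_cons il orbT /B1.
    case: eqP => [ik|_]; first by rewrite -ik il in kl.
    exact.
  have HE : P (E `&` Y k @^-1` A) = (P E * mu A)%E.
    have := H (fun=> setT) (fun=> measurableT).
    rewrite big1 ?mule1; last by move=> i _; exact: probability_setT.
    by rewrite setIidl// => w _ i _.
  split=> [//|B' mB']; rewrite IH//.
  - by rewrite HE.
  - exact: measurableI (mYk _ _).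
  - by move=> B0 mB0; rewrite H// HE.
pose Z (w : T) : R * R := (Y k w, S l w).
have mZ : measurable_fun [set: T] Z.
  by apply/measurable_fun_pairP; split; [exact: measurable_funP|exact: mS].
have PEge0 : 0 <= fine (P E) by exact: fine_ge0.
have PEE : P E = (fine (P E))%:E by rewrite fineK// fin_num_measure.
pose m1 : {measure set (R * R) -> \bar R} :=
  measure_function_pushforward__canonical__measure_function_Measure
    (mrestr P mE) mZ.
pose m2 : {measure set (R * R) -> \bar R} :=
  mscale (NngNum PEge0) (mu \x weighted_law mu [seq c i | i <- l])%E.
have m12 X : measurable X -> m1 X = m2 X.
  apply: finite_measure_rectangle_unique.
    by rewrite /= /pushforward /mrestr preimage_setT setTI -ge0_fin_numE//
      fin_num_measure.
  move=> A1 A2 mA1 mA2; rewrite /m2 /= /mscale /= -PEE product_measure1E// muleA.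
  have [_ <-//] := indE' A1 mA1.
  rewrite /pushforward /mrestr; congr (P _).
  by apply/seteqP; split => w /=; tauto.
have -> : E `&` S (k :: l) @^-1` B = (Z @^-1` (axpy (c k) @^-1` B)) `&` E.
  by apply/seteqP; split => w; rewrite /= /axpy /S /= big_cons => -[].
have -> : P ((Z @^-1` (axpy (c k) @^-1` B)) `&` E) = m1 (axpy (c k) @^-1` B) by [].
rewrite m12; first by rewrite /m2 /= /mscale /= -PEE.
by rewrite -[_ @^-1` _]setTI; exact: measurable_axpy.
Qed.

End independent_sum.

(** The order of [l] is free, so the two coordinates of a transfer can be put at its end. *)
Lemma perm_weighted_sum_law (R : realType) d (T : measurableType d)
    (P : probability T R) (n : nat) (Y : 'I_n -> {RV P >-> R})
    (mu : probability R R) (a : 'rV[R]_n) (l : seq 'I_n) (B : set R) :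
  (forall i A, measurable A -> P (Y i @^-1` A) = mu A) ->
  mutually_independent Y -> perm_eq l (enum 'I_n) -> measurable B ->
  P (weighted_sum a Y @^-1` B) = weighted_law mu [seq a 0 i | i <- l] B.
Proof.
move=> law_Y indY lP mB.
have ul : uniq l by rewrite (perm_uniq lP) enum_uniq.
have := @independent_event_sum R d T P _ Y mu (a 0) l setT ul measurableT.
rewrite probability_setT => H.
have mYA i A : measurable A -> measurable (Y i @^-1` A).
  by move=> mA; rewrite -[_ @^-1` _]setTI; exact: measurable_funP.
have {}H := H _ B mB; rewrite mul1e setTI in H.
rewrite -H.
  congr (P _); apply/seteqP; split => w /=.
    by rewrite /weighted_sum_fun (perm_big _ lP)/= big_enum.
  by rewrite /weighted_sum_fun (perm_big _ lP)/= big_enum.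
move=> B0 mB0; rewrite mul1e setTI.
have := indY [set i | i \in l]%SET B0 (fun i _ => mB0 i).
have -> : [set` [set i | i \in l]%SET] = [set i | i \in l] :> set 'I_n.
  by apply/seteqP; split => i; rewrite /= inE.
move=> ->; rewrite big_uniq//=.
apply: eq_big => [i|i _]; first by rewrite inE.
exact: law_Y.
Qed.

(** * Tails of weighted sums *)

Section weighted_law_tail.
Context {R : realType} (mu : probability R R).
Local Notation tail cs t := (weighted_law mu cs `]t, +oo[%classic).

Lemma xsection_axpy (c t y : R) :
  xsection (axpy c @^-1` `]t, +oo[) y = `](t - c * y)%R, +oo[%classic.
Proof.
apply/seteqP; split => z; rewrite /xsection /= in_itv/= andbT ltrBlDl.
  by move=> /set_mem; rewrite /axpy /= in_itv/= andbT.
by move=> ?; apply: mem_set; rewrite /axpy /= in_itv/= andbT.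
Qed.

Lemma weighted_law_cons_tail (c : R) (cs : seq R) (t : R) :
  tail (c :: cs) t = (\int[mu]_y tail cs (t - c * y)%R)%E.
Proof.
rewrite /= /distribution /pushforward /product_measure1.
apply: eq_integral => y _ /=; congr (weighted_law mu cs _).
by rewrite -xsection_axpy.
Qed.

Lemma measurable_weighted_law_tail (c : R) (cs : seq R) (t : R) :
  measurable_fun [set: R] (fun y => tail cs (t - c * y)).
Proof.
pose A : set (R * R) := axpy c @^-1` `]t, +oo[.
have mA : measurable A.
  by rewrite /A -[_ @^-1` _]setTI; exact: measurable_axpy.
rewrite (_ : (fun y => _) = weighted_law mu cs \o xsection A).
  exact: measurable_fun_xsection.
apply/funext => y /=; congr (weighted_law mu cs _).
by rewrite -xsection_axpy.
Qed.

(** This is the conditioning on the other summands: the weights in [r] are integrated out one by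
    one, each shifting the threshold, whence the hypothesis for all [t]. *)
Lemma weighted_law_tail_mono (r cs cs' : seq R) :
  (forall t, (tail cs t <= tail cs' t)%E) ->
  forall t, (tail (r ++ cs) t <= tail (r ++ cs') t)%E.
Proof.
move=> H; elim: r => [//|c r IH] t; rewrite !cat_cons !weighted_law_cons_tail.
apply: (@ge0_le_integral _ R R mu setT measurableT
  (fun y => tail (r ++ cs) (t - c * y)) (fun y => tail (r ++ cs') (t - c * y)) _
  (measurable_weighted_law_tail c _ t) (measurable_weighted_law_tail c _ t)).
- by [].
- by move=> y _; exact: IH.
Qed.

Lemma weighted_law1_tail (c t : R) :
  tail [:: c] t = (\int[mu]_y (t < c * y)%R%:R%:E)%E.
Proof.
rewrite weighted_law_cons_tail; apply: eq_integral => y _ /=.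
rewrite diracE; congr ((nat_of_bool _)%:R%:E); apply/idP/idP.
  by move=> /set_mem/=; rewrite in_itv/= andbT subr_lt0.
by move=> ?; rewrite mem_set//= in_itv/= andbT subr_lt0.
Qed.

End weighted_law_tail.

Section pair_law.
Context {R : realType}.
Variables (p q : R) (f : R -> R) (P : probability R R).
Hypotheses (p1 : 1 < p) (mf : measurable_fun (`]0, +oo[ : set R) f).
Hypotheses (f0 : forall y, 0 < y -> 0 <= f y).
Hypothesis (Pf : forall A : set R, measurable A ->
  P A = (\int[@lebesgue_measure R]_(y in A `&` `]0%R, +oo[) (f y)%:E)%E).

Lemma weighted_law2_tail (C c t : R) :
  weighted_law P [:: c `^ q^-1; (C - c) `^ q^-1] `]t, +oo[%classic =
  pair_tail p q f C t c.
Proof.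
set a1 := c `^ q^-1; set a2 := (C - c) `^ q^-1.
have mpow : measurable_fun [set: R] (fun y : R => y `^ p^-1).
  exact: measurable_powR.
rewrite weighted_law_cons_tail (integral_law_power_density p1 mf f0 Pf)//; last first.
  exact: measurable_weighted_law_tail.
apply: eq_integral => x _.
have mlt s : measurable_fun [set: R] (fun y : R => (s < a2 * y)%R%:R : R).
  rewrite (_ : (fun _ => _) = (fun y => if s < a2 * y then 1 else 0)).
    apply: measurable_fun_ifT => //; apply: measurable_fun_ltr => //.
  by apply/funext => z; case: ifP.
rewrite weighted_law1_tail (integral_law_power_density p1 mf f0 Pf)//; last first.
  by apply/measurable_EFinP; exact: mlt.
rewrite -ge0_integralZr//; last 3 first.
- apply: emeasurable_funM; apply/measurable_EFinP.
    exact: (@measurableT_comp _ _ _ _ _ _ _ _ _ (mlt _) mpow).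
  exact: measurable_power_density.
- by move=> y _; rewrite mule_ge0// lee_fin power_density_ge0.
- by rewrite lee_fin power_density_ge0.
apply: eq_integral => y _; rewrite -!EFinM; congr (_%:E).
by rewrite ltrBlDl -mulrA (mulrC (power_density _ _ y)).
Qed.

End pair_law.

(** * Majorization by transfers *)

Section transfers.
Context {R : realType} {n : nat} {disp : Order.disp_t} {V : porderType disp}.
Variable phi : 'rV[R]_n -> V.
Hypothesis transfer_le : forall (b b' : 'rV[R]_n) (i j : 'I_n),
  positive_orthant b -> positive_orthant b' -> i != j ->
  (forall k, k != i -> k != j -> b' 0 k = b 0 k) ->
  b' 0 i + b' 0 j = b 0 i + b 0 j ->
  b 0 i <= b' 0 i -> b' 0 i <= b' 0 j -> (phi b <= phi b')%O.

(** Induction on the number of coordinates where [a] and [b] differ. For the last [i] with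
    [b 0 i < a 0 i], the tail condition at [i] yields a later [j] with [a 0 j < b 0 j], and a
    transfer from [j] to [i] makes one of the two agree with [a]. Only [a] is sorted, as transfers
    may disorder [b]. *)
Lemma sorted_majorized_le (a b : 'rV[R]_n) :
  positive_orthant a -> positive_orthant b ->
  {homo a 0 : i j / (i <= j)%N >-> i <= j} ->
  \sum_i a 0 i = \sum_i b 0 i ->
  (forall m : nat, \sum_(i < n | (m <= i)%N) a 0 i <=
                   \sum_(i < n | (m <= i)%N) b 0 i) ->
  (phi b <= phi a)%O.
Proof.
have [N] := ubnP #|[set k | a 0 k != b 0 k]%SET|.
elim: N => // N IH in b *; rewrite ltnS => leN a0 b0 a_sorted sumE tail.
have [/eqP|] := eqVneq #|[set k | a 0 k != b 0 k]%SET| 0%N.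
  rewrite cards_eq0 => /eqP E0; suff -> : a = b by [].
  apply/rowP => k; apply/eqP/negPn/negP => abk.
  by have := finset.in_set0 k; rewrite -E0 inE abk.
rewrite cards_eq0 => /set0Pn [k0]; rewrite inE => abk0.
have [i0 ba0] : exists i, b 0 i < a 0 i.
  apply/existsP; apply: contraT => /existsPn H.
  have ab i : a 0 i <= b 0 i by rewrite leNgt.
  have : \sum_i a 0 i < \sum_i b 0 i.
    rewrite (bigD1 k0)//= [ltRHS](bigD1 k0)//=.
    by apply: ltr_leD; [rewrite lt_neqAle abk0 ab|apply: ler_sum].
  by rewrite sumE ltxx.
pose i := [arg max_(i > i0 | (b 0%R i < a 0%R i)%R) val i]%N.
have [bai imax] : b 0 i < a 0 i /\ forall k : 'I_n, (i < k)%N -> a 0 k <= b 0 k.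
  rewrite /i; case: arg_maxnP => // k bak kmax; split => // l kl.
  by rewrite leNgt; apply/negP => /kmax /=; apply/negP; rewrite -ltnNge.
have [j /andP[ltij abj]] : exists j : 'I_n, (i < j)%N && (a 0 j < b 0 j).
  apply/existsP; apply: contraT => /existsPn H.
  have : \sum_(k < n | (i <= k)%N) b 0 k < \sum_(k < n | (i <= k)%N) a 0 k.
    rewrite (bigD1 i)//= [ltRHS](bigD1 i)//=; apply: ltr_leD => //.
    apply: ler_sum => k /andP[ik ki].
    have := H k; rewrite ltn_neqAle ik eq_sym andbT.
    by rewrite -(inj_eq val_inj) eq_sym in ki; rewrite eq_sym ki /= -leNgt.
  by rewrite ltNge tail.
have ij : i != j by rewrite -(inj_eq val_inj) ltn_eqF.
(* The largest amount that overshoots neither coordinate of [a]. The new values satisfy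
   [b' 0 i <= a 0 i <= a 0 j <= b' 0 j], so the transfer does not cross the midpoint. *)
pose del := Num.min (b 0 j - a 0 j) (a 0 i - b 0 i).
have del0 : 0 < del by rewrite lt_min !subr_gt0 abj.
have deli : del <= a 0 i - b 0 i by rewrite ge_min lexx orbT.
have delj : del <= b 0 j - a 0 j by rewrite ge_min lexx.
pose b' : 'rV[R]_n := \row_k (if k == i then b 0 i + del
                              else if k == j then b 0 j - del else b 0 k).
have b'i : b' 0 i = b 0 i + del by rewrite mxE eqxx.
have b'j : b' 0 j = b 0 j - del by rewrite mxE eq_sym (negbTE ij) eqxx.
have b'k k : k != i -> k != j -> b' 0 k = b 0 k.
  by move=> ki kj; rewrite mxE (negbTE ki) (negbTE kj).
have aij : a 0 i <= a 0 j by apply: a_sorted; exact: ltnW.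
have b'0 : positive_orthant b'.
  move=> k; have := b0 k; have := a0 k.
  have [->|ki] := eqVneq k i; first by rewrite b'i; lra.
  have [->|kj] := eqVneq k j; first by rewrite b'j; lra.
  by rewrite b'k.
have tail_eq m : (m <= i)%N ->
    \sum_(k < n | (m <= k)%N) b' 0 k = \sum_(k < n | (m <= k)%N) b 0 k.
  move=> mi; rewrite (bigD1 i)//= [RHS](bigD1 i)//=.
  have mj : (m <= j)%N && (j != i) by rewrite (leq_trans mi (ltnW ltij)) eq_sym.
  rewrite (bigD1 j mj)/= [X in _ = _ + X](bigD1 j mj)/= b'i b'j.
  rewrite (eq_bigr (b 0)); last by move=> k /andP[/andP[_ ki] kj]; rewrite b'k.
  lra.
apply: (@le_trans _ _ (phi b')).
  by apply: (transfer_le b0 b'0 ij b'k); rewrite ?b'i ?b'j; lra.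
apply: IH => //.
- apply: leq_trans leN; apply: proper_card; apply/properP; split.
    apply/fintype.subsetP => k; rewrite !inE; apply: contraNN => /eqP abk.
    have [ki|ki] := eqVneq k i; first by move: bai; rewrite -ki abk ltxx.
    have [kj|kj] := eqVneq k j; first by move: abj; rewrite -kj abk ltxx.
    by rewrite b'k// abk.
  have [dE|dE] := leP (b 0 j - a 0 j) (a 0 i - b 0 i).
    exists j; rewrite !inE; first by rewrite lt_eqF.
    by rewrite negbK b'j /del min_l//; apply/eqP; lra.
  exists i; rewrite !inE; first by rewrite gt_eqF.
  by rewrite negbK b'i /del min_r ?(ltW dE)//; apply/eqP; lra.
- rewrite sumE; have := tail_eq 0%N (leq0n _).
  by under eq_bigl do rewrite leq0n; under [in RHS]eq_bigl do rewrite leq0n.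
(* Tails containing [i] also contain [j] and are unchanged; beyond [i], maximality of [i] gives a
   termwise comparison. *)
- move=> m; have [mi|im] := leqP m i; first by rewrite tail_eq.
  apply: ler_sum => k mk; have ik := leq_trans im mk.
  have ki : k != i by rewrite -(inj_eq val_inj) gtn_eqF.
  have [->|kj] := eqVneq k j; first by rewrite b'j; lra.
  by rewrite b'k// imax.
Qed.

Hypothesis phi_perm : forall (s : 'S_n) (a : 'rV[R]_n),
  positive_orthant a -> phi (col_perm s a) = phi a.

Lemma majorized_le (a b : 'rV[R]_n) :
  positive_orthant a -> positive_orthant b -> majorized a b ->
  (phi b <= phi a)%O.
Proof.
move=> a0 b0 [sumE tail].
pose so (c : 'rV[R]_n) : seq R := sort <=%R [seq c 0 i | i : 'I_n].
pose srt (c : 'rV[R]_n) : 'rV[R]_n := \row_i nth 0 (so c) i.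
have size_so c : size (so c) = n by rewrite size_sort size_map size_enum_ord.
have perm_srt c : exists s, srt c = col_perm s c.
  have : perm_eq (so c) [tuple c 0 i | i < n].
    by rewrite perm_sort /= -val_ord_tuple; exact: perm_refl.
  move=> /tuple_permP [s sE]; exists s; apply/rowP => i; rewrite !mxE.
  by rewrite sE (nth_map i) ?size_enum_ord// nth_ord_enum tnth_mktuple.
have srt0 c : positive_orthant c -> positive_orthant (srt c).
  by move=> c0 i; have [s ->] := perm_srt c; rewrite mxE.
have phi_srt c : positive_orthant c -> phi (srt c) = phi c.
  by move=> c0; have [s ->] := perm_srt c; exact: phi_perm.
have sum_srt c : \sum_i srt c 0 i = \sum_i c 0 i.
  have [s ->] := perm_srt c; rewrite [RHS](reindex_inj (@perm_inj _ s)).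
  by apply: eq_bigr => i _; rewrite mxE.
have tail_srt c m : \sum_(i < n | (m <= i)%N) srt c 0 i =
    \sum_(m.+1 <= i < n.+1) order_stat c i.
  rewrite big_add1/= big_geq_mkord.
  by apply: eq_bigr => i _; rewrite mxE.
rewrite -(phi_srt a)// -(phi_srt b)//; apply: sorted_majorized_le.
- exact: srt0.
- exact: srt0.
- move=> i j ij; rewrite !mxE; apply: (@sorted_leq_nth _ <=%R) => //.
  + exact: le_trans.
  + by apply: sort_sorted; exact: le_total.
  + by rewrite inE size_so.
  + by rewrite inE size_so.
- by rewrite !sum_srt.
(* Ranks count from 1 and indices from 0: the tail from index [m.+1] starts at rank [m.+2 >= 2], as
   in [majorized], and index 0 is the equality of sums. *)
- case=> [|m]; last first.
    rewrite !tail_srt; have [mn|nm] := leqP m.+2 n; first exact: tail.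
    by rewrite !big_geq.
  under eq_bigl do rewrite leq0n; under [leRHS]eq_bigl do rewrite leq0n.
  by rewrite !sum_srt sumE.
Qed.

End transfers.

(** * Transfers applied to the tail of the weighted sum *)

Section majorized_tail.
Context (R : realType) (d : measure_display) (T : measurableType d).
Variables (P : probability T R) (p q : R) (n : nat) (f : R -> R).
Variable Y : 'I_n -> {RV P >-> R}.
Hypotheses (p1 : 1 < p) (pq : p^-1 + q^-1 = 1) (n1 : (1 <= n)%N).
Hypothesis indY : mutually_independent Y.
Hypothesis densY : forall i, has_density_on (Y i) `]0, +oo[ f.
Hypothesis conc : ext_concave `]0, +oo[
  (fun x => (Num.min 0 (2 / p - 1) * ln x)%:E + lne (f (x `^ p^-1))%:E)%E.

Let mu : probability R R := distribution P (Y (Ordinal n1)).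

Let muE (A : set R) : measurable A ->
  mu A = (\int[@lebesgue_measure R]_(y in A `&` `]0%R, +oo[) (f y)%:E)%E.
Proof. by move=> mA; have [_ _] := densY (Ordinal n1); apply. Qed.

Let law_Y i (A : set R) : measurable A -> P (Y i @^-1` A) = mu A.
Proof.
by move=> mA; rewrite muE//; have [_ _] := densY i; apply.
Qed.

Let mf : measurable_fun (`]0, +oo[ : set R) f.
Proof. by have [] := densY (Ordinal n1). Qed.

Let f0 y : 0 < y -> 0 <= f y.
Proof.
by move=> y0; have [_ + _] := densY (Ordinal n1); apply; rewrite /= in_itv/= y0.
Qed.

Let tail (t : R) (c : 'rV[R]_n) : \bar R :=
  P (weighted_sum (entrywise_powR c q^-1) Y @^-1` `]t, +oo[).

Let tailE t c (l : seq 'I_n) : perm_eq l (enum 'I_n) ->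
  tail t c = weighted_law mu [seq (c 0 i) `^ q^-1 | i <- l] `]t, +oo[%classic.
Proof.
move=> lP; rewrite /tail (perm_weighted_sum_law _ law_Y indY lP)//.
by congr (weighted_law mu _ _); apply: eq_map => i; rewrite mxE.
Qed.

Let tail_perm t (s : 'S_n) c : tail t (col_perm s c) = tail t c.
Proof.
rewrite (tailE _ _ (perm_refl _)) (@tailE _ _ [seq s i | i <- enum 'I_n]).
  rewrite -[in RHS]map_comp; congr (weighted_law mu _ _).
  by apply: eq_map => i /=; rewrite mxE.
apply: uniq_perm; rewrite ?enum_uniq//.
  by rewrite map_inj_uniq ?enum_uniq//; exact: perm_inj.
move=> i; rewrite mem_enum inE; apply/mapP; exists (s^-1 i)%g.
  by rewrite mem_enum.
by rewrite permKV.
Qed.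

Let tail_transfer t (b b' : 'rV[R]_n) (i j : 'I_n) :
  positive_orthant b -> positive_orthant b' -> i != j ->
  (forall k, k != i -> k != j -> b' 0 k = b 0 k) ->
  b' 0 i + b' 0 j = b 0 i + b 0 j ->
  b 0 i <= b' 0 i -> b' 0 i <= b' 0 j -> (tail t b <= tail t b')%E.
Proof.
move=> b0 b'0 ij bk bs bi b'ij.
(* The pair goes last with [j] first: then [c] is the coordinate at [j], which decreases from
   [b 0 j] to [b' 0 j], still at least half of the sum [C]. *)
pose r := [seq k <- enum 'I_n | (k != i) && (k != j)].
have lP : perm_eq (r ++ [:: j; i]) (enum 'I_n).
  apply: uniq_perm; last 1 first; rewrite ?enum_uniq//.
    move=> k; rewrite mem_cat mem_filter mem_enum !inE andbT.
    by case: (k == i) => //=; case: (k == j).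
  rewrite cat_uniq filter_uniq ?enum_uniq//=.
  by rewrite !mem_filter !eqxx/= andbF !inE eq_sym ij.
rewrite !(tailE _ _ lP) !map_cat /=.
have -> : [seq (b 0 k) `^ q^-1 | k <- r] = [seq (b' 0 k) `^ q^-1 | k <- r].
  by apply/eq_in_map => k; rewrite mem_filter => /andP[/andP[ki kj] _]; rewrite bk.
have biE : b 0 i = b 0 i + b 0 j - b 0 j by lra.
have b'iE : b' 0 i = b 0 i + b 0 j - b' 0 j by lra.
apply: weighted_law_tail_mono => {}t; rewrite {1}biE b'iE.
rewrite !(weighted_law2_tail q p1 mf f0 muE).
have := b0 i; have := b0 j; have := b'0 i; have := b'0 j => ? ? ? ?.
by apply: (pair_tail_anti p1 pq mf f0 conc); lra.
Qed.

Lemma majorized_tail_le t (a b : 'rV[R]_n) :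
  positive_orthant a -> positive_orthant b -> majorized a b ->
  (P (weighted_sum (entrywise_powR b q^-1) Y @^-1` `]t, +oo[) <=
   P (weighted_sum (entrywise_powR a q^-1) Y @^-1` `]t, +oo[))%E.
Proof.
move=> a0 b0 ab; apply: (@majorized_le R n _ _ (tail t)) => //.
- exact: tail_transfer.
Qed.

Lemma permuted_tail t (s : 'S_n) (a : 'rV[R]_n) :
  P (weighted_sum (entrywise_powR (col_perm s a) q^-1) Y @^-1` `]t, +oo[) =
  P (weighted_sum (entrywise_powR a q^-1) Y @^-1` `]t, +oo[).
Proof. exact: tail_perm. Qed.

End majorized_tail.

Lemma fine_cdfE (R : realType) d (T : measurableType d) (P : probability T R)
    (X : {RV P >-> R}) (t : R) :
  fine (cdf X t) = 1 - fine (ccdf X t).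
Proof.
have := cdf_ccdf_1 X t.
have : cdf X t \is a fin_num by rewrite /cdf fin_num_measure.
have : ccdf X t \is a fin_num by rewrite /ccdf fin_num_measure.
by case: (cdf X t) => // x; case: (ccdf X t) => // y _ _ [<-]/=; rewrite addrK.
Qed.

Theorem theorem2 (R : realType)
    (d : measure_display) (T : measurableType d) (P : probability T R)
    (p q : R) (n : nat) (f : R -> R) (Y : 'I_n -> {RV P >-> R}) :
  1 < p ->
  p^-1 + q^-1 = 1 ->
  (1 <= n)%N ->
  mutually_independent Y ->
  (forall i, has_density_on (Y i) `]0, +oo[ f) ->
  ext_concave `]0, +oo[
    (fun x => (Num.min 0 (2 / p - 1) * ln x)%:E + lne (f (x `^ p^-1))%:E)%E ->
  (forall t : R, 0 < t ->
     schur_convex (@positive_orthant R n)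
       (fun c => fine (cdf (weighted_sum (entrywise_powR c q^-1) Y) t))) /\
  (forall a b : 'rV[R]_n, positive_orthant a -> positive_orthant b ->
     majorized (entrywise_powR a q) (entrywise_powR b q) ->
     st_le (weighted_sum b Y) (weighted_sum a Y)).
Proof.
move=> p1 pq n1 indY densY conc.
have ccdf_le t (a b : 'rV[R]_n) :
    positive_orthant a -> positive_orthant b -> majorized a b ->
    (ccdf (weighted_sum (entrywise_powR b q^-1) Y) t <=
     ccdf (weighted_sum (entrywise_powR a q^-1) Y) t)%E.
  by move=> a0 b0; exact: (majorized_tail_le p1 pq n1 indY densY conc).
split.
  move=> t _; split => [s a _|a b a0 b0 ab].
    rewrite !fine_cdfE; congr (- (1 - fine _)).
    exact: (permuted_tail q n1 indY densY).
  rewrite !fine_cdfE !opprB lerD2r.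
  apply: fine_le; rewrite ?fin_num_measure//.
  exact: ccdf_le.
have q0 : q != 0.
  apply/eqP => q0; move: pq; rewrite q0 invr0 addr0 => /eqP.
  by rewrite invr_eq1 gt_eqF.
have powRK (a : 'rV[R]_n) : positive_orthant a ->
    entrywise_powR (entrywise_powR a q) q^-1 = a.
  move=> a0; apply/rowP => i; rewrite !mxE -powRrM divff// powRr1//.
  exact: ltW.
move=> a b a0 b0 ab t.
(* The tail inequality is applied to the vectors of [q]-th powers. *)
rewrite -{1}(powRK b b0) -{1}(powRK a a0); apply: ccdf_le => //.
- by move=> i; rewrite mxE powR_gt0.
- by move=> i; rewrite mxE powR_gt0.
Qed.
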